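(* Let $\alpha\in(0,1)$, let $f$ be a log-concave density on $\mathbb{R}$, let $X_1,\dots,X_n$ be i.i.d. with density $f$, and let $\hat\ell,\hat\mu:\mathbb{R}\to[-\infty,\infty]$ be the functions computed from $X_1,\dots,X_n$ as defined in the context. Then $$\mathbb{P}_f\Bigl\{\exp(\hat\ell(x))\le f(x)\le\exp(\hat\mu(x))\ \text{ for all } x\in\mathbb{R}\Bigr\}\ \ge\ 1-\alpha .$$
   Context: A function $f:\mathbb{R}\to[0,\infty)$ is log-concave if $f=\exp\phi$ with $\phi:\mathbb{R}\to[-\infty,\infty)$ concave. $\log$ is the natural logarithm, $\log_2$ the base-2 logarithm. $X_{(j)}$ is the $j$th order statistic of the sample. Conventions: $\exp(-\infty)=0$, $\exp(+\infty)=+\infty$. Definitions. $s_n:=\lceil\log_2\log n\rceil$; $m:=\lfloor (n-1)/2^{s_n}\rfloor+1$; $x_i:=X_{(1+(i-1)2^{s_n})}$ for $i=1,\dots,m$ (almost surely $x_1<\dots<x_m$). $B_{max}:=\lfloor\log_2(n/8)\rfloor-s_n$; $n$ is assumed such that $B_{max}\ge 0$ (so $m\ge 8$). For $B=0,\dots,B_{max}$: $n_B:=\lfloor (n-1)/2^{B+s_n}\rfloor$ and $\mathcal{I}_B:=\{(j,k): j=1+(i-1)2^B,\ k=1+i2^B,\ i=1,\dots,n_B\}$. $t_n:=\sum_{B=0}^{B_{max}}\frac1{B+2}$. With $\mathrm{qBeta}(\gamma,r,s)$ the $\gamma$-quantile of the Beta$(r,s)$ distribution, $$c_B:=\mathrm{qBeta}\Bigl(\tfrac{\alpha}{2(B+2)n_Bt_n},2^{B+s_n},n+1-2^{B+s_n}\Bigr),\quad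 d_B:=\mathrm{qBeta}\Bigl(1-\tfrac{\alpha}{2(B+2)n_Bt_n},2^{B+s_n},n+1-2^{B+s_n}\Bigr).$$ $E(s):=\int_0^1 e^{st}\,dt$. For $\boldsymbol\ell=(\ell_1,\dots,\ell_m)\in\mathbb{R}^m$, $\boldsymbol g=(g_1,\dots,g_{m-1})\in\mathbb{R}^{m-1}$ and $i=1,\dots,m-1$: $L_i:=(x_{i+1}-x_i)e^{\ell_i}E(\ell_{i+1}-\ell_i)$; $U_i:=e^{\ell_i}(x_{i+1}-x_i)E(g_i(x_{i+1}-x_i))$ if $i=m-1$, and $U_i:=e^{\ell_{i+1}}(x_{i+1}-x_i)E(g_{i+1}(x_i-x_{i+1}))$ if $1\le i\le m-2$; $V_i:=e^{\ell_i}(x_{i+1}-x_i)E(g_i(x_{i+1}-x_i))$ if $2\le i\le m-1$, and $V_i:=e^{\ell_{i+1}}(x_{i+1}-x_i)E(g_{i+1}(x_i-x_{i+1}))$ if $i=1$. Constraints on $(\boldsymbol\ell,\boldsymbol g)$: (C1) $\ell_j\le\ell_i+g_i(x_j-x_i)$ for all $i\in\{2,\dots,m-1\}$, $j\in\{i-1,i+1\}$; and for all $B=0,\dots,B_{max}$ and all $(j,k)\in\mathcal{I}_B$: (C2) $c_B\le\sum_{i=j}^{k-1}U_i$; (C3) $c_B\le\sum_{i=j}^{k-1}V_i$; (C4) $\sum_{i=j}^{k-1}L_i\le d_B$. If no $(\boldsymbol\ell,\boldsymbol g)$ satisfies (C1)-(C4), set $\hat\ell\equiv+\infty$ and $\hat\mu\equiv-\infty$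 on $\mathbb{R}$. Otherwise, define for $i=1,\dots,m$: $\hat\ell(x_i):=\inf \ell_i$ and $\hat\mu(x_i):=\sup\ell_i$, both over all $(\boldsymbol\ell,\boldsymbol g)$ satisfying (C1)-(C4) (values in $[-\infty,\infty]$), and extend to $\mathbb{R}$ as follows. Lower bound: $\hat\ell(x):=\hat\ell(x_i)+(x-x_i)\frac{\hat\ell(x_{i+1})-\hat\ell(x_i)}{x_{i+1}-x_i}$ for $x\in(x_i,x_{i+1})$, $1\le i\le m-1$ (and $:=-\infty$ there if $\hat\ell(x_i)$ or $\hat\ell(x_{i+1})$ is $-\infty$); $\hat\ell(x):=-\infty$ for $x\notin[x_1,x_m]$. Upper bound: $L_k:=\min_{1\le j\le k-1}\frac{\hat\mu(x_k)-\hat\ell(x_j)}{x_k-x_j}$ for $2\le k\le m$, $R_k:=\max_{k+1\le j\le m}\frac{\hat\ell(x_j)-\hat\mu(x_k)}{x_j-x_k}$ for $1\le k\le m-1$, and, with $x_0:=-\infty$, $x_{m+1}:=\infty$ and $0\cdot(\pm\infty)=0$: $\hat\mu(x):=\hat\mu(x_{i+1})+R_{i+1}(x-x_{i+1})$ for $x\in(x_i,x_{i+1})$, $i\in\{0,1\}$; $\hat\mu(x):=\min\bigl(\hat\mu(x_i)+L_i(x-x_i),\ \hat\mu(x_{i+1})+R_{i+1}(x-x_{i+1})\bigr)$ for $x\in[x_i,x_{i+1})$, $2\le i\le m-2$; $\hat\mu(x):=\hat\mu(x_i)+L_i(x-x_i)$ for $x\in[x_i,x_{i+1})$, $i\in\{m-1,m\}$.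 *)

(* Defs.v *)
From HB Require Import structures.
From mathcomp Require Import all_boot all_order all_algebra.
From mathcomp Require Import all_classical all_reals all_analysis.

Set Implicit Arguments.
Unset Strict Implicit.
Unset Printing Implicit Defensive.

Import Order.TTheory GRing.Theory Num.Theory.
Import numFieldNormedType.Exports.

Local Open Scope classical_set_scope.
Local Open Scope ring_scope.

Section Densities.
Context {R : realType}.

(* [expeR] is the extended exponential, with value 0 at -oo. *)
Definition log_concave (f : R -> R) : Prop :=
  exists phi : R -> \bar R,
    [/\ forall x, phi x != +oo%E,
        forall (x y t : R), 0 <= t <= 1 ->
          (t%:E * phi x + (1 - t)%:E * phi y <= phi (t * x + (1 - t) * y)%R)%E
      & forall x, (f x)%:E = expeR (phi x)].

Definition is_density (f : R -> R) : Prop :=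
  [/\ measurable_fun [set: R] f,
      forall x, 0 <= f x
    & (\int[lebesgue_measure]_x (f x)%:E = 1)%E].

Context {d : measure_display} {T : measurableType d} (P : probability T R).

Definition has_density (Y : {RV P >-> R}) (f : R -> R) : Prop :=
  forall A : set R, measurable A ->
    distribution P Y A = (\int[lebesgue_measure]_(x in A) (f x)%:E)%E.

Definition mutually_independent (I : finType) (X : I -> {RV P >-> R}) : Prop :=
  forall (J : {set I}) (A : I -> set R), (forall i, measurable (A i)) ->
    P [set w | forall i, i \in J -> A i (X i w)] =
    (\prod_(i in J) P (X i @^-1` A i))%E.

Definition iid_with_density (I : finType) (X : I -> {RV P >-> R})
    (f : R -> R) : Prop :=
  mutually_independent X /\ forall i, has_density (X i) f.

End Densities.

Section Tuning.
Context (R : realType).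

Definition log2 (x : R) : R := ln x / ln 2.

Definition quantile (mu : probability (measurableTypeR R) R) (gamma : R) : R :=
  inf [set x : R | (gamma%:E <= mu `]-oo, x]%classic)%E].

Definition qBeta (gamma : R) (a b : nat) : R := quantile (beta_prob a b) gamma.

Context (n : nat).

(* The absolute values in [s_] and [Bmax] only change the type from [int] to
   [nat]: the ceiling is nonnegative for n >= 2, and [BmaxZ] is assumed to be
   nonnegative. *)
Definition s_ : nat := `|Num.ceil (log2 (ln n%:R))|%N.

Definition m_ : nat := ((n - 1) %/ 2 ^ s_).+1.

Definition BmaxZ : int := Num.floor (log2 (n%:R / 8)) - s_%:Z.

Definition Bmax : nat := `|BmaxZ|%N.

Definition n_ (B : nat) : nat := ((n - 1) %/ 2 ^ (B + s_))%N.

Definition I_ (B : nat) : set (nat * nat) :=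
  [set ((1 + (i - 1) * 2 ^ B)%N, (1 + i * 2 ^ B)%N)
     | i in [set i : nat | (1 <= i <= n_ B)%N]].

Definition t_ : R := \sum_(0 <= B < Bmax.+1) (B + 2)%:R^-1.

Definition level (alpha : R) (B : nat) : R :=
  alpha / (2 * (B + 2)%:R * (n_ B)%:R * t_).

Definition c_ (alpha : R) (B : nat) : R :=
  qBeta (level alpha B) (2 ^ (B + s_)) (n + 1 - 2 ^ (B + s_)).

Definition d_ (alpha : R) (B : nat) : R :=
  qBeta (1 - level alpha B) (2 ^ (B + s_)) (n + 1 - 2 ^ (B + s_)).

End Tuning.

(* Following the mathematical convention, entries of vectors and order
   statistics are numbered from 1. *)
Definition entry (R : realType) (v : seq R) (i : nat) : R := v`_(i.-1).

Section ConfidenceBand.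
Context (R : realType) (alpha : R) (n : nat) (X : 'I_n -> R).

Local Notation m := (m_ R n).

Definition order_stat (j : nat) : R := entry (sort <=%R (codom X)) j.

Definition x_ (i : nat) : R := order_stat (1 + (i - 1) * 2 ^ s_ R n).

Definition E_ (s : R) : R :=
  \int[lebesgue_measure]_(t in `[0%R, 1%R]) expR (s * t).

Section Constraints.
Context (l g : nat -> R).

Definition L_ (i : nat) : R :=
  (x_ i.+1 - x_ i) * expR (l i) * E_ (l i.+1 - l i).

Definition right_tangent (i : nat) : R :=
  expR (l i) * (x_ i.+1 - x_ i) * E_ (g i * (x_ i.+1 - x_ i)).

Definition left_tangent (i : nat) : R :=
  expR (l i.+1) * (x_ i.+1 - x_ i) * E_ (g i.+1 * (x_ i - x_ i.+1)).

Definition U_ (i : nat) : R :=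
  if i == m.-1 then right_tangent i else left_tangent i.

Definition V_ (i : nat) : R :=
  if i == 1%N then left_tangent i else right_tangent i.

Definition C1 : Prop :=
  forall i j : nat, (2 <= i <= m - 1)%N -> j = (i - 1)%N \/ j = (i + 1)%N ->
    l j <= l i + g i * (x_ j - x_ i).

Definition C2 (B : nat) (jk : nat * nat) : Prop :=
  c_ n alpha B <= \sum_(jk.1 <= i < jk.2) U_ i.

Definition C3 (B : nat) (jk : nat * nat) : Prop :=
  c_ n alpha B <= \sum_(jk.1 <= i < jk.2) V_ i.

Definition C4 (B : nat) (jk : nat * nat) : Prop :=
  \sum_(jk.1 <= i < jk.2) L_ i <= d_ n alpha B.

Definition constraints : Prop :=
  C1 /\ forall B : nat, (B <= Bmax R n)%N -> forall jk, I_ R n B jk ->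
    [/\ C2 B jk, C3 B jk & C4 B jk].

End Constraints.

Definition feasible : set (m.-tuple R * m.-1.-tuple R) :=
  [set lg : m.-tuple R * m.-1.-tuple R |
     constraints (entry lg.1) (entry lg.2)].

Local Open Scope ereal_scope.

Definition lower_knot (i : nat) : \bar R :=
  ereal_inf [set (entry lg.1 i)%:E | lg in feasible].

Definition upper_knot (i : nat) : \bar R :=
  ereal_sup [set (entry lg.1 i)%:E | lg in feasible].

(* The index i in {0, ..., m} with x_i <= x < x_(i+1), for x_0 = -oo and
   x_(m+1) = +oo: the x_i are sorted, so it suffices to count. *)
Definition cell (x : R) : nat := count (fun i => (x_ i <= x)%R) (iota 1 m).

Definition lower_band (x : R) : \bar R :=
  let i := cell x in
  if `[< feasible = set0 >] then +oo
  else if i == 0%N then -oo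
  else if x == x_ i then lower_knot i
  else if i == m then -oo
  else if (lower_knot i == -oo) || (lower_knot i.+1 == -oo) then -oo
  else lower_knot i + (x - x_ i)%:E *
         ((lower_knot i.+1 - lower_knot i) * ((x_ i.+1 - x_ i)^-1)%:E).

Definition slopeL (k : nat) : \bar R :=
  \big[mine/+oo]_(1 <= j < k)
     ((upper_knot k - lower_knot j) * ((x_ k - x_ j)^-1)%:E).

Definition slopeR (k : nat) : \bar R :=
  \big[maxe/-oo]_(k.+1 <= j < m.+1)
     ((lower_knot j - upper_knot k) * ((x_ j - x_ k)^-1)%:E).

Definition lineL (i : nat) (x : R) : \bar R :=
  upper_knot i + slopeL i * (x - x_ i)%:E.

Definition lineR (i : nat) (x : R) : \bar R :=
  upper_knot i + slopeR i * (x - x_ i)%:E.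

(* The products below satisfy 0 * (+oo) = 0 * (-oo) = 0, as required. *)
Definition upper_band (x : R) : \bar R :=
  let i := cell x in
  if `[< feasible = set0 >] then -oo
  else if i == 0%N then lineR 1 x
  else if i == 1%N then (if x == x_ 1 then upper_knot 1 else lineR 2 x)
  else if (i <= m - 2)%N then mine (lineL i x) (lineR i.+1 x)
  else lineL i x.

End ConfidenceBand.

(* Lower bound on the probability of an event that need not be known to be
   measurable; for a measurable event E it says that p <= P E. *)
Definition probability_at_least (R : realType) (d : measure_display)
    (T : measurableType d) (P : probability T R) (E : set T) (p : R) : Prop :=
  exists A : set T, [/\ measurable A, A `<=` E & (p%:E <= P A)%E].

(* Main.v *)
Require Import Defs.
From HB Require Import structures.
From mathcomp Require Import all_boot all_order all_algebra.
From mathcomp Require Import all_classical all_reals all_analysis.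
From mathcomp Require Import measurable_realfun.
From mathcomp Require Import zify ring lra.

Set Implicit Arguments.
Unset Strict Implicit.
Unset Printing Implicit Defensive.

Import Order.TTheory GRing.Theory Num.Theory.
Import numFieldNormedType.Exports.

Local Open Scope classical_set_scope.
Local Open Scope ring_scope.

(** The knots x_1 < ... < x_m are order statistics of the sample.  Put
    l_i := ln (f (x_i)) and, for 1 < i < m, let g_i be the slope of a supporting
    line of the concave function ln f at x_i.  Between two knots f lies above
    the log-linear interpolation of its values and below its log-linear
    tangents, so L_i <= F (x_(i+1)) - F (x_i) <= U_i, V_i for the distribution
    function F of f.  Hence (l, g) satisfies all the constraints as soon as
    every spacing F (x_k) - F (x_j) with (j, k) in I_B lies in [c_B, d_B]
    ([true_log_density_constraints]).  On that event the lower and upper bounds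
    at the knots enclose ln f (x_i), and three-chord inequalities for concave
    functions extend this to the real line ([lower_band_le], [le_upper_band]).

    It remains to bound the probability that a spacing leaves [c_B, d_B].  The
    variables U_i := F (X_i) are independent and uniform on [0, 1]
    ([uniform01_density_cdf]), they have almost surely no ties, and F commutes
    with sorting.  The (p + r)-th minus the p-th order statistic (counted from
    0) of n uniform variables exceeds x with probability

      \sum_(i < r) C(n, i) x^i (1 - x)^(n - i)      ([spacing_probability]),

    which is the tail at x of the beta distribution with parameters r and
    n + 1 - r ([beta_prob_tail]).  The formula comes from splitting the event
    according to the index a of the p-th order statistic, the set S1 of the
    indices to its left, and the set S2 of the indices within distance x to
    its right, where #|S2| < r.  Given U_a = y, such a pattern has probability
    y^#|S1| x^#|S2| (1 - x - y)^(n - 1 - #|S1| - #|S2|)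
    ([independent_slices]); integrating over y yields an expression that
    depends on #|S2| alone after multiplication by the number of choices of
    (a, S1), and the sum over S2 is the stated one.

    As c_B and d_B are the quantiles of these beta distributions at levels
    level_B and 1 - level_B, each spacing of scale B is bad with probability
    at most 2 level_B, and the levels are chosen such that the union bound over
    all scales and spacings gives alpha ([level_sum_le]). *)

(** * Binomial tails and the beta distribution *)

Section Calculus.
Context {R : realType}.
Local Notation mu := (@lebesgue_measure R).

Lemma integral_derivative (F f : R -> R) (a b : R) : a <= b ->
  (forall x : R, is_derive x 1 F (f x)) -> continuous f ->
  (\int[mu]_(x in `[a, b]) (f x)%:E = (F b - F a)%:E)%E.
Proof.
rewrite le_eqVlt => /predU1P[<- _ _|ab dF cf].
  by rewrite set_itv1 integral_set1 subrr.
have cF : continuous F.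
  move=> x; apply: differentiable_continuous.
  by apply/derivable1_diffP; have := dF x.
rewrite EFinB; apply: continuous_FTC2 => //.
- by apply: continuous_subspaceT => x; exact: cf.
- split.
  + by move=> x _; have := dF x.
  + by apply: cvg_at_right_filter; exact: cF.
  + by apply: cvg_at_left_filter; exact: cF.
- by move=> x _; rewrite derive1E; have := dF x => ?; exact: derive_val.
Qed.

(** For y = 1 this is the probability that a binomial variable with parameters n
    and u is less than r.  The homogeneous form in u and y - u covers at the same
    time the beta tails (y = 1) and the integrals over [0, 1 - x] that arise from
    spacings (y = 1 - x). *)
Definition binomial_tail (n r : nat) (y u : R) : R :=
  \sum_(i < r) 'C(n, i)%:R * (u ^+ i * (y - u) ^+ (n - i)).

Lemma is_derive_binomial_term (p q : nat) (y u : R) :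
  is_derive u 1 (fun v => v ^+ p * (y - v) ^+ q)
    (p%:R * (u ^+ p.-1 * (y - u) ^+ q) - q%:R * (u ^+ p * (y - u) ^+ q.-1)).
Proof.
have -> : (fun v => v ^+ p * (y - v) ^+ q) = id ^+ p * (cst y - id) ^+ q.
  by apply/funext => v; rewrite !fctE.
apply: is_derive_eq.
rewrite !fctE /GRing.scale /=; ring.
Qed.

(** The derivatives of consecutive terms telescope, by the two absorption
    identities for binomial coefficients; only one term survives. *)
Lemma is_derive_binomial_tail (n r : nat) (y u : R) : (r <= n)%N ->
  is_derive u 1 (binomial_tail n.+1 r.+1 y)
    (- (n.+1 * 'C(n, r))%:R * (u ^+ r * (y - u) ^+ (n - r))).
Proof.
elim: r => [_|r IHr rn].
  have -> : binomial_tail n.+1 1 y = fun v => v ^+ 0 * (y - v) ^+ n.+1.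
    by apply/funext => v; rewrite /binomial_tail big_ord1 bin0 mul1r.
  have H := is_derive_binomial_term 0 n.+1 y u.
  apply: (is_derive_eq H).
  rewrite /= bin0 muln1 !expr0 subn0; ring.
have {}IHr := IHr (ltnW rn).
have -> : binomial_tail n.+1 r.+2 y = binomial_tail n.+1 r.+1 y +
      'C(n.+1, r.+1)%:R *: (fun u => u ^+ r.+1 * (y - u) ^+ (n - r)).
  by apply/funext => v; rewrite /binomial_tail big_ord_recr /= subSS !fctE.
have H := is_derive_binomial_term r.+1 (n - r) y u.
apply: is_derive_eq; rewrite /GRing.scale /=.
have H1 : ((n.+1 * 'C(n, r))%:R : R) = r.+1%:R * 'C(n.+1, r.+1)%:R.
  by rewrite -natrM -mul_bin_diag.
have H2 : ((n.+1 * 'C(n, r.+1))%:R : R) = (n - r)%:R * 'C(n.+1, r.+1)%:R.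
  by rewrite -natrM (mul_bin_down n.+1 r.+1) subSS.
rewrite H1 H2 subnS; ring.
Qed.

Lemma binomial_tail_diag (n r : nat) (y : R) : (r <= n)%N ->
  binomial_tail n r y y = 0.
Proof.
move=> rn; rewrite /binomial_tail big1 // => i _.
by rewrite subrr expr0n subn_eq0 leqNgt (leq_trans (ltn_ord i)) // !mulr0.
Qed.

Lemma binomial_tail0 (n r : nat) (y : R) : binomial_tail n r.+1 y 0 = y ^+ n.
Proof.
rewrite /binomial_tail big_ord_recl bin0 expr0 !mul1r subr0 subn0.
by rewrite big1 ?addr0 // => i _; rewrite expr0n !mul0r mulr0.
Qed.

Lemma continuous_binomial_term (p q : nat) (y : R) :
  continuous (fun u : R => u ^+ p * (y - u) ^+ q).
Proof.
move=> u; apply: differentiable_continuous; apply/derivable1_diffP.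
by have := is_derive_binomial_term p q y u.
Qed.

(** The tail vanishes at u = y, because each of its terms keeps a positive power
    of y - u. *)
Lemma integral_binomial_term (n r : nat) (y a : R) : (r <= n)%N -> a <= y ->
  (\int[mu]_(u in `[a, y])
     (((n.+1 * 'C(n, r))%:R * (u ^+ r * (y - u) ^+ (n - r)))%:E) =
   (binomial_tail n.+1 r.+1 y a)%:E)%E.
Proof.
move=> rn ay.
pose dens (u : R) := (n.+1 * 'C(n, r))%:R * (u ^+ r * (y - u) ^+ (n - r)).
have dT (u : R) : is_derive u 1 (- binomial_tail n.+1 r.+1 y) (dens u).
  have H := is_derive_binomial_tail y u rn.
  by apply: is_derive_eq; rewrite mulNr opprK.
have cdens : continuous dens.
  by move=> u; apply: cvgM; [exact: cvg_cst | exact: continuous_binomial_term].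
rewrite (integral_derivative ay dT cdens) !fctE.
by rewrite binomial_tail_diag ?ltnS // oppr0 sub0r opprK.
Qed.

(** The normalising constant of the beta density with parameters r and n + 1 - r
    is n * C(n - 1, r - 1), so that the density is minus the derivative of the
    binomial tail. *)
Lemma beta_prob_tail (n r : nat) (x : R) : (0 < r <= n)%N -> 0 <= x <= 1 ->
  beta_prob r (n + 1 - r) `]x, +oo[ = (binomial_tail n r 1 x)%:E.
Proof.
case: r => // r; case: n => // n /andP[_]; rewrite ltnS => rn /andP[x0 x1].
rewrite -integral_beta_pdf //.
transitivity (\int[mu]_(u in `]x, 1%R])
    (((n.+1 * 'C(n, r))%:R * (u ^+ r * (1 - u) ^+ (n - r)))%:E))%E; last first.
  rewrite integral_itv_obnd_cbnd ?integral_binomial_term//.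
  apply/measurable_EFinP/measurable_funTS/measurable_funM => //.
  by apply: continuous_measurable_fun; exact: continuous_binomial_term.
rewrite integral_mkcond [RHS]integral_mkcond; apply: eq_integral => u _.
rewrite !patchE !mem_setE !in_itv /= andbT /beta_pdf patchE mem_setE in_itv /=.
case: ltP => //= xu; rewrite (le_trans x0 (ltW xu)) /=.
case: leP => //= u1; last by rewrite mul0r.
have -> : (n.+1 + 1 - r.+1 = (n - r).+1)%N by lia.
rewrite beta_fun_fact /XMonemX /=; congr (_%:E).
rewrite subnKC // -[1 - u]/(unstable.onem u) mulrC; congr (_ * _).
rewrite invf_div factS -(bin_fact rn) mulnA natrM mulfK //.
Qed.

End Calculus.

(** * Conditioning on one member of an independent family *)

Section DensityMeasure.
Context {d : measure_display} {T : measurableType d} {R : realType}.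
Variables (mu : {measure set T -> \bar R}) (h : T -> \bar R).
Hypotheses (mh : measurable_fun setT h) (h_ge0 : forall x, (0 <= h x)%E).

(** The two hypotheses on h are arguments of the definition so that the structure
    of a measure can be attached to it. *)
Definition density_measure
  of measurable_fun setT h & (forall x, (0 <= h x)%E) : set T -> \bar R :=
  fun A => (\int[mu]_(x in A) h x)%E.

Local Notation nu := (density_measure mh h_ge0).

Let density_measure0 : nu set0 = 0%E.
Proof. exact: integral_set0. Qed.

Let density_measure_ge0 A : (0 <= nu A)%E.
Proof. exact: integral_ge0. Qed.

Let density_measure_sigma_additive : semi_sigma_additive nu.
Proof.
move=> F mF tF mUF; rewrite /density_measure; apply: cvg_toP.
  apply: ereal_nondecreasing_is_cvgn => k l kl.
  by apply: lee_sum_nneg_natr => // i _ _; exact: integral_ge0.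
by rewrite ge0_integral_bigcup //; exact: measurable_funTS.
Qed.

HB.instance Definition _ := isMeasure.Build _ _ _ nu
  density_measure0 density_measure_ge0 density_measure_sigma_additive.

End DensityMeasure.

Section JointLaw.
Context {R : realType} {d : measure_display} {T : measurableType d}.
Variable P : probability T R.
Local Open Scope ereal_scope.

(** Both sides are finite measures in C, and measurable rectangles form a
    generating class that is stable under intersection.  The event G is arbitrary,
    which makes the lemma usable inside an induction. *)
Lemma rectangle_joint_law (Y Z : {RV P >-> R}) (G : set T) (h : R -> \bar R)
    (mu nu : probability R R) :
  measurable G -> measurable_fun setT h -> (forall y, 0 <= h y) ->
  (forall A A' : set R, measurable A -> measurable A' ->
    P (G `&` (Y @^-1` A `&` Z @^-1` A')) = (\int[mu]_(y in A) h y) * nu A') ->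
  forall C : set (R * R), measurable C ->
    P (G `&` [set w | C (Y w, Z w)]) = \int[mu]_y (h y * nu (xsection C y)).
Proof.
move=> mG mh h0 rect.
have mYZ : measurable_fun setT (fun w => (Y w, Z w)) by exact/measurable_fun_pair.
have mh2 : measurable_fun setT (fun z : R * R => h z.1) by exact: measurableT_comp.
have h2_ge0 (z : R * R) : 0 <= h z.1 by [].
pose rects := [set C : set (R * R) |
  exists A A', [/\ measurable A, measurable A' & C = A `*` A']].
have nuE C : measurable C ->
    density_measure (mu \x nu) mh2 h2_ge0 C =
    \int[mu]_y (h y * nu (xsection C y)).
  move=> mC; rewrite /density_measure integral_mkcond fubini_tonelli1 //=.
  - apply: eq_integral => y _; rewrite /fubini_F.
    transitivity (\int[nu]_z (h y * (\1_(xsection C y) z)%:E)).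
      apply: eq_integral => z _; rewrite patchE indicE /= -mem_xsection.
      rewrite (_ : (z \in xsection C y) = ((y, z) \in C)) ?mem_xsection //.
      by case: ifP => _; rewrite ?mule1 ?mule0.
    rewrite ge0_integralZl//; last first.
      by apply/measurable_EFinP; exact/measurable_indic/measurable_xsection.
    by rewrite integral_indic ?setIT//; exact: measurable_xsection.
  - by apply/measurable_restrict => //; rewrite setTI; exact: measurable_funTS.
  - by move=> z; rewrite patchE; case: ifP.
move=> C mC; rewrite -nuE //.
have -> : G `&` [set w | C (Y w, Z w)] = (fun w => (Y w, Z w)) @^-1` C `&` G.
  by rewrite setIC.
apply: (@measure_unique _ R _ rects (fun=> setT) _ _ _ _
  (pushforward (mrestr P mG) (fun w => (Y w, Z w)))
  (density_measure (mu \x nu) mh2 h2_ge0)) => //.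
- rewrite measurable_prod_measurableType; congr (<<s _ >>).
  rewrite predeqE => D; split => [[A mA [A' mA' <-]]|[A [A' [mA mA' ->]]]].
    by exists A, A'.
  by exists A => //; exists A'.
- move=> _ _ [A [A' [mA mA' ->]]] [B [B' [mB mB' ->]]].
  by exists (A `&` B), (A' `&` B'); split; rewrite ?setXI//; exact: measurableI.
- by move=> _; exists setT, setT; split => //; rewrite setXTT.
- by rewrite bigcup_const.
- move=> _ [A [A' [mA mA' ->]]];
  have /= nuA := nuE _ (measurableX mA mA'); rewrite [RHS]nuA.
  transitivity (P (G `&` (Y @^-1` A `&` Z @^-1` A'))).
    by rewrite /pushforward /mrestr /= setIC.
  rewrite rect // integral_mkcond -ge0_integralZr//=.
  + apply: eq_integral => y _; rewrite patchE.
    case: ifPn => [yA|yA]; first by rewrite in_xsectionX.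
    by rewrite notin_xsectionX // measure0 mul0e mule0.
  + by apply/measurable_restrict => //; rewrite setTI; exact: measurable_funTS.
  + by move=> y _; rewrite patchE; case: ifP.
- move=> _; rewrite /pushforward /mrestr /=.
  rewrite -[X in X < _]/(P (setT `&` G)) setTI.
  by rewrite (le_lt_trans (probability_le1 _ mG)) // ltry.
Qed.

Lemma emeasurable_prod d1 (S : measurableType d1) (I : Type) (s : seq I)
    (p : pred I) (g : I -> S -> \bar R) :
  (forall i, measurable_fun setT (g i)) ->
  measurable_fun setT (fun x => \prod_(i <- s | p i) g i x).
Proof.
move=> mg; elim: s => [|i s IHs].
  by under eq_fun do rewrite big_nil; exact: measurable_cst.
under eq_fun do rewrite big_cons.
by case: (p i) => //; apply: emeasurable_funM.
Qed.

Section Slices.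
Variables (I : finType) (U : I -> {RV P >-> R}).

(** Conditioning on the coordinate U_a: given U_a = y, the events that constrain
    the other coordinates relative to y are independent.  The proof replaces
    rectangles by general sets B i for one index i after the other; for
    rectangles the claim is the independence of the family. *)
Lemma independent_slices (a : I) (B : I -> set (R * R)) :
  mutually_independent U -> (forall i, measurable (B i)) ->
  P [set w | forall i, i != a -> B i (U a w, U i w)] =
  \int[distribution P (U a)]_y
    (\prod_(i | i != a) distribution P (U i) (xsection (B i) y)).
Proof.
move=> indep mB.
pose slices (B : I -> set (R * R)) :=
  P [set w | forall i, i != a -> B i (U a w, U i w)] =
  \int[distribution P (U a)]_y
    (\prod_(i | i != a) distribution P (U i) (xsection (B i) y)).
suff {B mB} main (s : seq I) : forall B : I -> set (R * R),
    (forall i, measurable (B i)) ->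
    (forall i, i \notin s -> exists A A',
      [/\ measurable A, measurable A' & B i = A `*` A']) -> slices B.
  by apply: (main (enum I)) => // i; rewrite mem_enum.
elim: s => [|b s IHs] B mB rectB.
  (* all B i are rectangles A i * A' i: the constraints on U a are intersected *)
  have /choice[A /choice[A' AA']] : forall i, exists A A' : set R,
      [/\ measurable A, measurable A' & B i = A `*` A'].
    by move=> i; apply: rectB.
  pose C i := if i == a then \bigcap_(j in [set j | j != a]) A j else A' i.
  have mC i : measurable (C i).
    rewrite /C; case: eqP => // _; last by have [] := AA' i.
    apply: fin_bigcap_measurable => [|j _]; first exact: finite_finset.
    by have [] := AA' j.
  rewrite /slices.
  have -> : [set w | forall i, i != a -> B i (U a w, U i w)] =
            [set w | forall i, i \in [set: I]%SET -> C i (U i w)].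
    apply/seteqP; split => w /= Bw i.
      move=> _; rewrite /C; case: eqP => [->|/eqP ia].
        by move=> j /= ja; have [_ _ BE] := AA' j; have := Bw j ja; rewrite BE => -[].
      by have [_ _ BE] := AA' i; have := Bw i ia; rewrite BE => -[].
    move=> ia; have [_ _ ->] := AA' i; split => /=.
      by have := Bw a (finset.in_setT a); rewrite /C eqxx; apply.
    by have := Bw i (finset.in_setT i); rewrite /C (negbTE ia).
  rewrite indep // (bigD1 a) ?finset.in_setT //=.
  rewrite (eq_bigl (fun i => i != a)) => [|i]; last by rewrite finset.in_setT.
  rewrite [X in _ * X](eq_bigr (fun i => distribution P (U i) (A' i))); last first.
    by move=> i ia; rewrite /C (negbTE ia).
  rewrite -[P _]/(distribution P (U a) (C a)) -[C a]setIT -integral_indic//.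
  rewrite -ge0_integralZr//=; last 2 first.
  + exact/measurable_EFinP/measurable_indic.
  + by apply: prode_ge0 => i _.
  apply: eq_integral => y _; rewrite indicE.
  have [yC|yC] := boolP (y \in C a).
    rewrite mul1e; apply: eq_bigr => i ia; have [_ _ ->] := AA' i.
    rewrite in_xsectionX // inE.
    by move: yC; rewrite inE /C eqxx; apply.
  have [j ja yAj] : exists2 j, j != a & y \notin A j.
    move: yC; rewrite notin_setE /C eqxx => /existsNP[j] /not_implyP[ja].
    by move=> /= yAj; exists j => //; rewrite notin_setE.
  rewrite mul0e (bigD1 j) //=; have [_ _ ->] := AA' j.
  by rewrite notin_xsectionX // measure0 mul0e.
have [ba|ba] := eqVneq b a.
  have := IHs (fun i => if i == a then setT `*` setT else B i); rewrite /slices.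
  have -> : [set w | forall i, i != a ->
      (if i == a then setT `*` setT else B i) (U a w, U i w)] =
      [set w | forall i, i != a -> B i (U a w, U i w)].
    by apply/seteqP; split => w /= Bw i ia; have := Bw i ia; rewrite (negbTE ia).
  under eq_integral do under eq_bigr => i ia do rewrite (negbTE ia).
  apply=> [i|i si]; case: eqP => [_|/eqP ia].
  - exact: measurableX.
  - exact: mB.
  - by exists setT, setT.
  - by apply: rectB; rewrite inE negb_or ba ia.
pose upd (C : set (R * R)) i := if i == b then C else B i.
have -> : B = upd (B b).
  by apply/funext => i; rewrite /upd; case: eqP => // ->.
pose G := [set w | forall i, i != a -> i != b -> B i (U a w, U i w)].
pose H y := \prod_(i | (i != a) && (i != b)) distribution P (U i) (xsection (B i) y).
have LE C : [set w | forall i, i != a -> upd C i (U a w, U i w)] =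
    G `&` [set w | C (U a w, U b w)].
  apply/seteqP; split => w /= => [Cw|[Gw Cw] i ia].
    split=> [i ia ib|]; first by have := Cw i ia; rewrite /upd (negbTE ib).
    by have := Cw b ba; rewrite /upd eqxx.
  by rewrite /upd; case: eqP => [->//|/eqP ib]; exact: Gw.
have RE C y : \prod_(i | i != a) distribution P (U i) (xsection (upd C i) y) =
    H y * distribution P (U b) (xsection C y).
  rewrite (bigD1 b) //= muleC /upd eqxx; congr (_ * _).
  by apply: eq_bigr => i /andP[_ /negbTE->].
rewrite /slices LE; under eq_integral do rewrite RE.
have rectUpd (A A' : set R) : measurable A -> measurable A' ->
    P (G `&` (U a @^-1` A `&` U b @^-1` A')) =
    \int[distribution P (U a)]_y
      (H y * distribution P (U b) (xsection (A `*` A') y)).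
  move=> mA mA'.
  rewrite -[LHS]/(P (G `&` [set w | (A `*` A') (U a w, U b w)])).
  rewrite -LE; under eq_integral do rewrite -RE.
  apply: IHs => [i|i si]; rewrite /upd.
    by case: eqP => // _; exact: measurableX.
  case: eqP => [_|ib]; first by exists A, A'.
  by apply: rectB; rewrite inE negb_or si andbT; apply/eqP.
have mH : measurable_fun setT H.
  by apply: emeasurable_prod => i; exact: measurable_fun_xsection.
have H0 y : 0 <= H y by apply: prode_ge0.
apply: rectangle_joint_law => //.
  rewrite (_ : G = \bigcap_(i in [set i | (i != a) && (i != b)])
      ((fun w => (U a w, U i w)) @^-1` B i)).
    apply: fin_bigcap_measurable => [|i _]; first exact: finite_finset.
    rewrite -[X in measurable X]setTI.
    have mp : measurable_fun setT (fun w => (U a w, U i w)).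
      exact/measurable_fun_pair.
    exact: mp.
  apply/seteqP; split => w Gw i /=.
    by move=> /andP[ia ib]; exact: Gw.
  by move=> ia ib; apply: (Gw i); rewrite /= ia ib.
move=> A A' mA mA'; rewrite rectUpd // [in RHS]integral_mkcond -ge0_integralZr//=.
+ apply: eq_integral => y _; rewrite patchE.
  case: ifPn => [yA|yA]; first by rewrite in_xsectionX.
  by rewrite notin_xsectionX // measure0 mul0e mule0.
+ by apply/measurable_restrict => //; rewrite setTI; exact: measurable_funTS.
+ by move=> y _; rewrite patchE; case: ifP.
Qed.
End Slices.
End JointLaw.

(** * Patterns of independent uniform variables *)

Section UniformSpacings.
Context {R : realType} {d : measure_display} {T : measurableType d}.
Variables (P : probability T R) (I : finType) (U : I -> {RV P >-> R}).
Local Notation mu := (@lebesgue_measure R).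

Definition uniform01 (V : {RV P >-> R}) : Prop :=
  forall A : set R, measurable A -> P (V @^-1` A) = mu (A `&` `[0, 1]).

(** The position of the value z of index i relative to the pivot value y: indices
    in S1 are to the left, those in S2 at distance at most x to the right, and all
    the others further to the right. *)
Definition slot (S1 S2 : {set I}) (x : R) (i : I) (y z : R) : bool :=
  if i \in S1 then z < y else if i \in S2 then y < z <= y + x else y + x < z.

Definition pattern (x : R) (a : I) (S1 S2 : {set I}) : set T :=
  [set w | forall i, i != a -> slot S1 S2 x i (U a w) (U i w)].

Lemma measurable_slot S1 S2 x i :
  measurable [set z : R * R | slot S1 S2 x i z.1 z.2].
Proof.
rewrite -[X in measurable X]setTI.
suff mb : measurable_fun setT (fun z : R * R => slot S1 S2 x i z.1 z.2).
  by apply: (mb _ [set true]).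
rewrite /slot; case: (i \in S1); first exact: measurable_fun_ltr.
have mD : measurable_fun setT (fun z : R * R => z.1 + x).
  exact: measurable_funD.
case: (i \in S2); last exact: measurable_fun_ltr.
apply: measurable_and; first exact: measurable_fun_ltr.
exact: measurable_fun_ler.
Qed.

Lemma measurable_pattern x a S1 S2 : measurable (pattern x a S1 S2).
Proof.
rewrite (_ : pattern _ _ _ _ = \bigcap_(i in [set i | i != a])
    ((fun w => (U a w, U i w)) @^-1` [set z | slot S1 S2 x i z.1 z.2])) //.
apply: fin_bigcap_measurable => [|i _]; first exact: finite_finset.
rewrite -[X in measurable X]setTI.
have mp : measurable_fun setT (fun w => (U a w, U i w)).
  exact/measurable_fun_pair.
by apply: mp => //; exact: measurable_slot.
Qed.

Lemma integral_uniform01 (V : {RV P >-> R}) (h : R -> \bar R) : uniform01 V ->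
  measurable_fun setT h -> (forall y, 0 <= h y)%E ->
  (\int[distribution P V]_y h y = \int[mu]_(y in `[0%R, 1%R]) h y)%E.
Proof.
move=> unifV mh h0.
transitivity (\int[uniform_prob (@ltr01 R)]_y h y)%E; last first.
  by rewrite integral_uniform // subr0 invr1 mul1e.
(* the identity transports the uniform law between the two measurable
   structures on the real line *)
pose idR : measurableTypeR R -> R := fun y => y.
have midR : measurable_fun setT idR by move=> _ A mA; rewrite setTI.
transitivity (\int[pushforward (uniform_prob (@ltr01 R)) idR]_y h y)%E; last first.
  by rewrite ge0_integral_pushforward.
apply: eq_measure_integral => A mA _.
rewrite /= /distribution /pushforward unifV //.
rewrite /uniform_prob integral_uniform_pdf.
rewrite -[LHS]mul1e -integral_cst//; last exact: measurableI.
by apply: eq_integral => y; rewrite inE => -[_ /=]; rewrite in_itv /= /uniform_pdf => ->; rewrite subr0 invr1.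
Qed.

(** The conditional probability of [slot] given a pivot value y with
    x + y <= 1. *)
Definition share (x y : R) (S1 S2 : {set I}) (i : I) : R :=
  if i \in S1 then y else if i \in S2 then x else 1 - x - y.

Lemma uniform01_slot (V : {RV P >-> R}) (S1 S2 : {set I}) x i y : uniform01 V ->
  0 <= x -> 0 <= y -> x + y <= 1 ->
  distribution P V (xsection [set z | slot S1 S2 x i z.1 z.2] y) =
  (share x y S1 S2 i)%:E.
Proof.
move=> unifV x0 y0 xy1.
rewrite /distribution /pushforward unifV; last first.
  by apply: measurable_xsection; exact: measurable_slot.
have -> : xsection [set z | slot S1 S2 x i z.1 z.2] y =
    [set z | slot S1 S2 x i y z].
  by apply/seteqP; split => z; rewrite xsectionE.
rewrite /slot /share; case: ifP => _.
  rewrite (_ : _ `&` _ = `[0, y[%classic).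
    by rewrite lebesgue_measure_itv /= lte_fin; case: ltgtP y0 => [||<-] // _;
      rewrite ?oppr0 ?adde0 //=.
  apply/seteqP; split => z /=; rewrite !in_itv /=; lra.
case: ifP => _.
  rewrite (_ : _ `&` _ = `]y, y + x]%classic).
    rewrite lebesgue_measure_itv /= lte_fin ltrDl.
    case: ltgtP x0 => [||<-] // _; by rewrite ?subrr // -?EFinB addrC addKr.
  apply/seteqP; split => z /=; rewrite !in_itv /=; lra.
rewrite (_ : _ `&` _ = `]y + x, 1]%classic).
  rewrite lebesgue_measure_itv /= lte_fin addrC.
  have -> : 1 - x - y = 1 - (x + y) by ring.
  by case: ltgtP xy1 => [_|_|->] //; rewrite subrr.
apply/seteqP; split => z /=; rewrite !in_itv /=; lra.
Qed.

Lemma uniform01_slot_out (V : {RV P >-> R}) (S1 S2 : {set I}) x i y : uniform01 V ->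
  i \notin S1 -> i \notin S2 -> 1 < x + y ->
  distribution P V (xsection [set z | slot S1 S2 x i z.1 z.2] y) = 0%E.
Proof.
move=> unifV i1 i2 xy1.
rewrite /distribution /pushforward unifV; last first.
  by apply: measurable_xsection; exact: measurable_slot.
rewrite (_ : _ `&` _ = set0) ?measure0 //.
apply/seteqP; split => z //=; rewrite xsectionE /= /slot (negbTE i1) (negbTE i2).
rewrite in_itv /=; lra.
Qed.

Hypotheses (indep : mutually_independent U) (unif : forall i, uniform01 (U i)).

Lemma prod_share x y a (S1 S2 : {set I}) :
  a \notin S2 -> S1 \subset ~: (a |: S2) ->
  \prod_(i | i != a) share x y S1 S2 i =
  y ^+ #|S1| * (x ^+ #|S2| * (1 - x - y) ^+ #|~: (a |: S2) :\: S1|).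
Proof.
move=> aS2 /fintype.subsetP sS1.
have S1a i : i \in S1 -> (i == a) = false /\ (i \in S2) = false.
  by move=> /sS1; rewrite !inE negb_or => /andP[/negbTE-> /negbTE->].
rewrite (bigID (mem S1)) /= (eq_bigl (mem S1)) => [|i]; last first.
  by rewrite /=; case: (boolP (i \in S1)) => [/S1a[->]|]; rewrite ?andbF.
rewrite (eq_bigr (fun=> y)) => [|i iS1]; last by rewrite /share (iS1 : i \in S1).
rewrite prodr_const; congr (_ * _).
rewrite (bigID (mem S2)) /= (eq_bigl (mem S2)) => [|i]; last first.
  rewrite /=; case: (boolP (i \in S2)) => [iS2|]; rewrite ?andbF ?andbT //.
  have -> : i != a by apply: contraNneq aS2 => <-.
  by apply: contraL iS2 => /S1a[_ ->].
rewrite (eq_bigr (fun=> x)) => [|i iS2]; last first.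
  by rewrite /share (iS2 : i \in S2); case: ifP => // /S1a[_]; rewrite (iS2 : i \in S2).
rewrite prodr_const; congr (_ * _).
rewrite (eq_bigl (mem (~: (a |: S2) :\: S1))) => [|i]; last first.
  by rewrite !inE negb_or; case: (i \in S1); case: (i \in S2); case: (i == a).
rewrite -prodr_const; apply: eq_bigr => i.
by rewrite !inE negb_or /share => /and3P[/negbTE-> _ /negbTE->].
Qed.

(** Integrate the conditional probability of the pattern over the pivot value.  At
    least one index lies in neither S1 nor S2, hence pivot values above 1 - x do
    not contribute, and the remaining beta integral over [0, 1 - x] is
    [integral_binomial_term] at its lower endpoint. *)
Lemma pattern_probability x a (S1 S2 : {set I}) N : 0 <= x <= 1 ->
  a \notin S2 -> S1 \subset ~: (a |: S2) ->
  #|I| = (#|S1| + #|S2| + N).+2 ->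
  (((#|S1| + N).+2 * 'C((#|S1| + N).+1, #|S1|))%:R%:E * P (pattern x a S1 S2) =
   (x ^+ #|S2| * (1 - x) ^+ (#|S1| + N).+2)%:E)%E.
Proof.
move=> /andP[x0 x1] aS2 sS1 cardI.
have cardS3 : #|~: (a |: S2) :\: S1| = N.+1.
  rewrite cardsDS // cardsCs finset.setCK cardsU1 aS2 cardI; lia.
rewrite /pattern (independent_slices a indep (measurable_slot S1 S2 x)).
rewrite integral_uniform01 //; last 2 first.
- by apply: emeasurable_prod => i; apply: measurable_fun_xsection; exact: measurable_slot.
- by move=> y; apply: prode_ge0.
transitivity (\int[mu]_(y in `[0%R, (1 - x)%R]) (x ^+ #|S2| *
   (((#|S1| + N).+2 * 'C((#|S1| + N).+1, #|S1|))%:R *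
    (y ^+ #|S1| * (1 - x - y) ^+ ((#|S1| + N).+1 - #|S1|))))%:E)%E; last first.
  under eq_integral do rewrite EFinM.
  rewrite ge0_integralZl //=; last 3 first.
  - apply/measurable_EFinP/measurable_funTS/measurable_funM => //.
    by apply: continuous_measurable_fun; exact: continuous_binomial_term.
  - move=> y; rewrite in_itv /= => /andP[y0 y1]; rewrite lee_fin.
    by rewrite !mulr_ge0 ?exprn_ge0 ?subr_ge0.
  - by rewrite lee_fin exprn_ge0.
  rewrite integral_binomial_term ?binomial_tail0 //; first by lia.
  by rewrite subr_ge0.
rewrite -ge0_integralZl //=; last 2 first.
- apply: measurable_funTS; apply: emeasurable_prod => i.
  by apply: measurable_fun_xsection; exact: measurable_slot.
- by move=> y _; apply: prode_ge0.
rewrite integral_mkcond [RHS]integral_mkcond; apply: eq_integral => y _.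
rewrite !patchE !mem_setE !in_itv /=.
have [y0|y0] //= := leP 0 y.
have [y1|y1] := leP y (1 - x).
  have -> : y <= 1 by lra.
  rewrite (eq_bigr (fun i => (share x y S1 S2 i)%:E)) => [|i _]; last first.
    by rewrite uniform01_slot //; lra.
  rewrite prodEFin prod_share // cardS3 -EFinM; congr (_%:E).
  have -> : ((#|S1| + N).+1 - #|S1| = N.+1)%N by lia.
  ring.
case: ifP => // _.
have [i iS3] : exists i, i \in ~: (a |: S2) :\: S1.
  by apply/set0Pn; rewrite -card_gt0 cardS3.
move: iS3; rewrite !inE negb_or => /and3P[iS1 ia iS2].
rewrite (bigD1 i) //= uniform01_slot_out ?mul0e ?mule0 //; lra.
Qed.

End UniformSpacings.

(** * Spacings of uniform order statistics *)

Section Patterns.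
Context {R : realType} (I : finType).
Implicit Types (u : I -> R) (x : R) (S : {set I}).

(** The index is ((S2, a), S1): S2 comes first because the final sum runs over S2
    after a and S1 have been summed out. *)
Definition spacing_indices (p r : nat) : pred ({set I} * I * {set I}) :=
  fun t => [&& (#|t.1.1| < r)%N, t.1.2 \notin t.1.1,
               t.2 \subset ~: (t.1.2 |: t.1.1) & #|t.2| == p].

(** A pattern determines its two index sets; this makes patterns disjoint. *)
Lemma slot_sets u x a S1 S2 : 0 <= x -> a \notin S2 ->
  S1 \subset ~: (a |: S2) ->
  (forall i, i != a -> slot S1 S2 x i (u a) (u i)) ->
  S1 = [set i | u i < u a]%SET /\ S2 = [set i | u a < u i <= u a + x]%SET.
Proof.
move=> x0 aS2 /fintype.subsetP sS1 pat.
have aS1 : a \notin S1.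
  by apply/negP => /sS1; rewrite !inE eqxx.
split; apply/setP => i; rewrite inE.
  have [->|ia] := eqVneq i a; first by rewrite ltxx (negbTE aS1).
  have := pat i ia; rewrite /slot.
  by case: ifP => [_ ->//|_]; case: ifP => _ h; apply/esym/negbTE; lra.
have [->|ia] := eqVneq i a; first by rewrite ltxx (negbTE aS2).
have := pat i ia; rewrite /slot; case: ifP => [iS1 h|_].
  have : i \notin S2 by have := sS1 _ iS1; rewrite !inE negb_or => /andP[].
  by move=> /negbTE->; apply/esym/negbTE; lra.
by case: ifP => // _ h; apply/esym/negbTE; lra.
Qed.

Lemma count_codom (q : pred R) u : count q (codom u) = #|[set i | q (u i)]%SET|.
Proof.
by rewrite codomE count_map cardsE -sum1_count -sum1_card big_enum_cond.
Qed.

(** When there are no ties, the spacing between the ranks p and p + r exceeds x iff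
    fewer than r values lie within distance x to the right of the value of rank
    p.  Ranks are counted from 0. *)
Lemma spacing_patternP u x p r : injective u -> 0 <= x -> (p + r < #|I|)%N ->
  let s := sort <=%R (codom u) in
  (exists2 t, spacing_indices p r t &
     forall i, i != t.1.2 -> slot t.2 t.1.1 x i (u t.1.2) (u i))
  <-> s`_p + x < s`_(p + r).
Proof.
move=> inju x0 prI s.
have ss : sorted <=%O s by exact: (sort_sorted le_total).
have sizes : size s = #|I| by rewrite size_sort size_codom.
have cs q : count q s = #|[set i | q (u i)]%SET|.
  by rewrite -count_codom; apply/permP; rewrite perm_sort.
have pI : (p < #|I|)%N by apply: leq_ltn_trans prI; exact: leq_addr.
have low a : #|[set i | u i <= u a]%SET| = #|[set i | u i < u a]%SET|.+1.
  rewrite (_ : [set i | u i <= u a]%SET = a |: [set i | u i < u a]%SET).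
    by rewrite cardsU1 inE ltxx.
  apply/setP => i; rewrite !inE le_eqVlt; congr (_ || _).
  by apply/eqP/eqP => [/inju|->].
have high a : #|[set i | u i <= u a + x]%SET| =
    (#|[set i | u i < u a]%SET| + #|[set i | u a < u i <= u a + x]%SET|).+1.
  rewrite -addSn -low -cardsUI (_ : _ :&: _ = finset.set0) ?cards0 ?addn0.
    apply: eq_card => i; rewrite !inE; apply/idP/idP; lra.
  by apply/setP => i; rewrite !inE; apply/negbTE; lra.
split=> [[[[S2 a] S1]] /= /and4P[/= S2r aS2 sS1 /eqP S1p] pat|sx].
  have [S1E S2E] := slot_sets x0 aS2 sS1 pat.
  have -> : s`_p = u a.
    by apply: nth_count_eq => //; rewrite !cs low -S1E S1p leqnn ltnSn.
  apply: nth_count_gt => //; rewrite sizes prI andbT cs high -S1E -S2E S1p.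
  by rewrite -addnS leq_add2l.
have /codomP[a sa] : s`_p \in codom u.
  by rewrite -(mem_sort <=%R) mem_nth // sizes.
exists ([set i | u a < u i <= u a + x]%SET, a, [set i | u i < u a]%SET) => /=.
  have cp : #|[set i | u i < u a]%SET| = p.
    rewrite -(cs (fun z => z < u a)) -sa; apply: count_lt_nth; rewrite ?sizes //.
    rewrite lt_sorted_uniq_le ss andbT sort_uniq.
    by apply/dinjectiveP => i j _ _; exact: inju.
  apply/and4P; split => /=.
  - rewrite ltnNge; apply/negP => rS2; move: sx; apply/negP; rewrite -leNgt sa.
    by apply: nth_count_le => //; rewrite cs high cp ltnS leq_add2l.
  - by rewrite inE ltxx.
  - by apply/fintype.subsetP => i; rewrite !inE; case: eqP => [->|_]; rewrite ?ltxx //; lra.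
  - by rewrite cp.
move=> i ia; rewrite /slot !inE.
have uia : u i != u a by apply: contra_neq ia => /inju.
case: ltP => // h; rewrite lt_neqAle eq_sym uia h /=.
by case: leP.
Qed.

End Patterns.

Lemma fsbig_pred (V : nmodType) (J : finType) (p : pred J) (F : J -> V) :
  \sum_(t \in [set` p]) F t = \sum_(t | p t) F t.
Proof.
have -> : [set` p] = [set` [seq t <- index_enum J | p t]].
  by apply/seteqP; split => t /=; rewrite mem_filter mem_index_enum andbT.
by rewrite -fsbig_seq ?big_filter // filter_uniq // index_enum_uniq.
Qed.

Section SpacingProbability.
Context {R : realType} {d : measure_display} {T : measurableType d}.
Variables (P : probability T R) (I : finType) (U : I -> {RV P >-> R}).

Definition spacing_event (p r : nat) (x : R) : set T :=
  \bigcup_(t in [set` spacing_indices p r]) pattern U x t.1.2 t.2 t.1.1.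

Lemma measurable_spacing_event p r x : measurable (spacing_event p r x).
Proof.
apply: fin_bigcup_measurable => [|t _]; last exact: measurable_pattern.
exact: finite_finset.
Qed.

(** If two patterns with pivots a and a' occur together, then a and a' have the same
    number p of values strictly to their left; distinct values have distinct
    ranks, so a = a'. *)
Lemma trivIset_pattern p r x : 0 <= x ->
  trivIset [set` spacing_indices (I := I) p r]
    (fun t => pattern U x t.1.2 t.2 t.1.1).
Proof.
move=> x0 [[S2 a] S1] [[S2' a'] S1'] /= tS tS' [w [wS wS']].
move: tS tS' => /and4P[/= _ aS2 sS1 /eqP S1p].
move=> /and4P[/= _ aS2' sS1' /eqP S1p'].
have [S1E S2E] := slot_sets x0 aS2 sS1 wS.
have [S1E' S2E'] := slot_sets x0 aS2' sS1' wS'.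
suff aa : a = a' by rewrite S1E S2E S1E' S2E' aa.
have mono b c : U b w < U c w ->
    (#|[set i | (U i w < U b w)%R]%SET| < #|[set i | (U i w < U c w)%R]%SET|)%N.
  move=> bc; apply/proper_card/properP; split.
    by apply/fintype.subsetP => i; rewrite !inE => /lt_trans; apply.
  by exists b; rewrite !inE ?ltxx.
apply/eqP/negPn/negP => aa.
have := wS a'; rewrite eq_sym => /(_ aa) wa'.
have : U a w != U a' w.
  apply/eqP => e; move: wa'; rewrite /slot e ltxx; case: ifP => //.
  by case: ifP => //= _ _; lra.
rewrite neq_lt => /orP[] /mono; rewrite -S1E -S1E' S1p S1p' ltnn //.
Qed.

Hypotheses (indep : mutually_independent U) (unif : forall i, uniform01 (U i)).

(** Given S2, there are (n - #|S2|) * C(n - #|S2| - 1, p) choices of (a, S1), which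
    cancels the constant of [pattern_probability]; counting the sets S2 by
    cardinality leaves the binomial sum. *)
Lemma spacing_probability p r x : 0 <= x <= 1 -> (p + r < #|I|)%N ->
  P (spacing_event p r x) = (binomial_tail #|I| r 1 x)%:E.
Proof.
move=> x01 prI; have [x0 x1] := andP x01.
rewrite measure_fin_bigcup; last 3 first.
- exact: finite_finset.
- exact: trivIset_pattern.
- by move=> t _; exact: measurable_pattern.
pose q (t : {set I} * I * {set I}) : R :=
  x ^+ #|t.1.1| * (1 - x) ^+ (#|I| - #|t.1.1|) /
  ((#|I| - #|t.1.1|) * 'C((#|I| - #|t.1.1|).-1, p))%:R.
rewrite (eq_fsbigr (fun t => (q t)%:E)); last first.
  move=> [[S2 a] S1] /set_mem /and4P[/= S2r aS2 sS1 /eqP S1p].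
  pose N := (#|I| - 2 - p - #|S2|)%N.
  have cardI : #|I| = (#|S1| + #|S2| + N).+2 by rewrite S1p /N; lia.
  have := pattern_probability indep unif x01 aS2 sS1 cardI.
  rewrite /q /= S1p.
  have -> : (#|I| - #|S2| = (p + N).+2)%N by rewrite /N; lia.
  have : ((p + N).+2 * 'C((p + N).+1, p))%:R != 0 :> R.
    by rewrite pnatr_eq0 -lt0n muln_gt0 bin_gt0; lia.
  set c : R := _%:R => c0 E.
  rewrite [X in X = _](_ : _ = (c^-1)%:E * (c%:E * P (pattern U x a S1 S2)))%E.
    by rewrite E -EFinM mulrC.
  by rewrite muleA -EFinM mulVf // mul1e.
rewrite fsumEFin; last exact: finite_finset.
congr (_%:E).
transitivity (\sum_(t | spacing_indices p r t) q t).
  exact: fsbig_pred.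
have subsets (S2 : {set I}) a : (#|S2| < r)%N -> a \notin S2 ->
    \sum_(S1 : {set I} | (S1 \subset ~: (a |: S2)) && (#|S1| == p)) q (S2, a, S1) =
    x ^+ #|S2| * (1 - x) ^+ (#|I| - #|S2|) / (#|I| - #|S2|)%:R.
  move=> S2r aS2; rewrite /q /=.
  rewrite (eq_bigl (mem [set S1 : {set I} | (S1 \subset ~: (a |: S2)) & #|S1| == p]%SET)).
    rewrite sumr_const cards_draws [#|~: _|]cardsCs finset.setCK cardsU1 aS2 add1n subnS.
    rewrite -mulr_natr natrM; field.
    have nS2 : (#|S2| < #|I|)%N by lia.
    have b0 : (0 < 'C((#|I| - #|S2|).-1, p))%N by rewrite bin_gt0; lia.
    by rewrite !pnatr_eq0 -!lt0n subn_gt0 nS2 b0.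
  by move=> S1; rewrite !inE.
transitivity (\sum_(S2 : {set I} | (#|S2| < r)%N) \sum_(a | a \notin S2)
    \sum_(S1 : {set I} | (S1 \subset ~: (a |: S2)) && (#|S1| == p)) q (S2, a, S1)).
  rewrite pair_big_dep /= pair_big_dep /=.
  by apply: eq_bigl => -[[S2 a] S1]; rewrite /spacing_indices /= !andbA.
transitivity (\sum_(S2 : {set I} | (#|S2| < r)%N) x ^+ #|S2| * (1 - x) ^+ (#|I| - #|S2|)).
  apply: eq_bigr => S2 S2r.
  rewrite (eq_bigr (fun=> x ^+ #|S2| * (1 - x) ^+ (#|I| - #|S2|) / (#|I| - #|S2|)%:R)).
    rewrite (eq_bigl (mem (~: S2))) => [|a]; last by rewrite !inE.
    rewrite sumr_const [#|~: _|]cardsCs finset.setCK -[LHS]mulr_natr divfK //.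
    by rewrite pnatr_eq0 -lt0n; lia.
  by move=> a aS2; exact: subsets.
rewrite /binomial_tail.
transitivity (\sum_(i < r) \sum_(S2 : {set I} | #|S2| == i)
    x ^+ #|S2| * (1 - x) ^+ (#|I| - #|S2|)); last first.
  apply: eq_bigr => i _.
  rewrite (eq_bigr (fun=> x ^+ i * (1 - x) ^+ (#|I| - i))) => [|S2 /eqP-> //].
  rewrite (eq_bigl (mem [set S2 : {set I} | (S2 \subset [set: I]%SET) & #|S2| == i]%SET)).
    by rewrite sumr_const cards_draws cardsT mulr_natl.
  by move=> S2; rewrite !inE finset.subsetT.
rewrite (exchange_big_dep xpredT) //= [LHS]big_mkcond; apply: eq_bigr => S2 _.
case: ifPn => S2r.
  by rewrite (big_pred1 (Ordinal S2r)) // => i; rewrite eq_sym.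
rewrite big_pred0 // => i; apply: contraNF S2r => /eqP->; exact: ltn_ord.
Qed.
End SpacingProbability.

(** * The probability integral transform *)

Section Ties.
Context {R : realType} {d : measure_display} {T : measurableType d}.
Variables (P : probability T R) (I : finType) (U : I -> {RV P >-> R}).
Hypotheses (indep : mutually_independent U) (unif : forall i, uniform01 (U i)).

(** Given the value y of U_i, a tie confines U_j to a single point. *)
Lemma tie_probability i j : i != j -> P [set w | U i w = U j w] = 0%E.
Proof.
move=> ij.
pose B k := if k == j then [set z : R * R | z.1 = z.2] else setT.
have mdiag : measurable [set z : R * R | z.1 = z.2].
  rewrite -[X in measurable X]setTI.
  have me : measurable_fun setT (fun z : R * R => z.1 == z.2).
    exact: measurable_fun_eqr.
  rewrite (_ : [set z : R * R | _] = (fun z => z.1 == z.2) @^-1` [set true]).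
    exact: me.
  by apply/seteqP; split => z /= /eqP.
have mB k : measurable (B k) by rewrite /B; case: eqP.
have -> : [set w | U i w = U j w] = [set w | forall k, k != i -> B k (U i w, U k w)].
  apply/seteqP; split => w /= Bw.
    by move=> k _; rewrite /B; case: eqP => // ->.
  by have := Bw j; rewrite /B eqxx eq_sym; apply.
rewrite (independent_slices i indep mB); apply: integral0_eq => y _.
have mBy : measurable (xsection (B j) y) by exact: measurable_xsection.
have null : P (U j @^-1` xsection (B j) y) = 0%E.
  rewrite unif; last exact: measurable_xsection.
  apply/eqP; rewrite -measure_le0 -(lebesgue_measure_set1 y).
  apply: le_measure; rewrite ?inE //.
  - exact: measurableI.
  - by rewrite /B eqxx => z [] /=; rewrite xsectionE /= => ->.
by rewrite (bigD1 j) 1?eq_sym //= /distribution /pushforward null mul0e.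
Qed.

End Ties.

Section ProbabilityIntegralTransform.
Context {R : realType}.
Local Notation mu := (@lebesgue_measure R).
Variables (f : R -> R) (f_density : is_density f).

Definition density_cdf (x : R) : R := fine (\int[mu]_(t in `]-oo, x]) (f t)%:E).

Let f0 t : 0 <= f t. Proof. by case: f_density. Qed.
Let mf : measurable_fun setT f. Proof. by case: f_density. Qed.
Let mEf (A : set R) : measurable_fun A (fun t => (f t)%:E).
Proof. exact/measurable_funTS/measurable_EFinP. Qed.

Lemma density_integral_le1 (A : set R) : measurable A ->
  (\int[mu]_(t in A) (f t)%:E <= 1)%E.
Proof.
move=> mA; have [_ _ <-] := f_density.
apply: ge0_subset_integral => //; first exact: mEf.
by move=> t _; rewrite lee_fin.
Qed.

Lemma density_integral_fin (A : set R) : measurable A ->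
  (\int[mu]_(t in A) (f t)%:E)%E \is a fin_num.
Proof.
move=> mA; rewrite ge0_fin_numE; last by apply: integral_ge0 => t _; rewrite lee_fin.
by rewrite (le_lt_trans (density_integral_le1 mA)) // ltry.
Qed.

Lemma density_cdfE x :
  (density_cdf x)%:E = (\int[mu]_(t in `]-oo, x]) (f t)%:E)%E.
Proof. by rewrite /density_cdf fineK // density_integral_fin. Qed.

Lemma density_cdf_ge0 x : 0 <= density_cdf x.
Proof.
by rewrite -lee_fin density_cdfE; apply: integral_ge0 => t _; rewrite lee_fin.
Qed.

Lemma density_cdf_le1 x : density_cdf x <= 1.
Proof. by rewrite -lee_fin density_cdfE density_integral_le1. Qed.

Lemma density_cdfB a b : a <= b ->
  (\int[mu]_(t in `]a, b]) (f t)%:E = (density_cdf b - density_cdf a)%:E)%E.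
Proof.
move=> ab; rewrite EFinB !density_cdfE.
have -> : `]-oo, b]%classic = `]-oo, a] `|` `]a, b].
  by rewrite -itv_bndbnd_setU // bnd_simp.
rewrite ge0_integral_setU //=.
- by rewrite addeAC subee ?add0e // density_integral_fin.
- exact: mEf.
- by move=> t _; rewrite lee_fin.
- by apply/disj_setPS => t [] /=; rewrite !in_itv /=; lra.
Qed.

Lemma density_cdf_homo : {homo density_cdf : a b / a <= b}.
Proof.
move=> a b ab; rewrite -subr_ge0 -lee_fin -density_cdfB //.
by apply: integral_ge0 => t _; rewrite lee_fin.
Qed.

Lemma measurable_density_cdf : measurable_fun setT density_cdf.
Proof. by apply: nondecreasing_measurable => //; exact: density_cdf_homo. Qed.

Lemma density_cdf_continuous a b : a <= b -> {within `[a, b], continuous density_cdf}.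
Proof.
move=> ab.
have intf : mu.-integrable `[a, b] (EFin \o f).
  apply/integrableP; split; first exact: mEf.
  under eq_integral do rewrite /= ger0_norm //.
  by rewrite (le_lt_trans (density_integral_le1 _)) // ltry.
have cint := parameterized_integral_continuous ab intf.
have cF : {within `[a, b], continuous
    (fun x => density_cdf a + \int[mu]_(t in `[a, x]) f t)}.
  by move=> x; apply: cvgD; [exact: cvg_cst | exact: cint].
apply: (subspace_eq_continuous _ cF) => x; rewrite inE /= in_itv /= => /andP[ax _].
have := density_cdfB ax; rewrite integral_itv_obnd_cbnd; last exact: mEf.
move=> /(congr1 fine) /= intE.
rewrite -[LHS]/(density_cdf a + fine (\int[mu]_(t in `[a, x]) (f t)%:E)%E) intE.
by rewrite addrC subrK.
Qed.

Context {d : measure_display} {T : measurableType d} (P : probability T R).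
Variables (X : {RV P >-> R}) (Xf : has_density X f).

Lemma density_cdf_surj (u : R) : 0 < u < 1 -> exists x, density_cdf x = u.
Proof.
move=> /andP[u0 u1].
have cdfE x : cdf X x = (density_cdf x)%:E by rewrite density_cdfE -Xf.
have [a au] : exists a, density_cdf a < u.
  have /fine_cvg /cvgr_lt := cvg_cdfNy0 X.
  by move=> /(_ u u0) /filter_ex[a]; rewrite /= cdfE => au; exists a.
have [b bu] : exists b, u < density_cdf b.
  have /fine_cvg /cvgr_gt := cvg_cdfy1 X.
  by move=> /(_ u u1) /filter_ex[b]; rewrite /= cdfE => bu; exists b.
have ab : a <= b.
  rewrite leNgt; apply/negP => /ltW /density_cdf_homo; lra.
have [||c _ <-] := @IVT R density_cdf a b u ab; last by exists c.
  exact: density_cdf_continuous.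
by rewrite ge_min le_max (ltW au) (ltW bu) orbT.
Qed.

(** Compare with the events c < X for F c = u from above and F c = v from below,
    where v decreases to u.  In this way F need not be invertible. *)
Lemma density_cdf_upper_tail (u : R) : 0 <= u < 1 ->
  P [set w | u < density_cdf (X w)] = (1 - u)%:E.
Proof.
move=> /andP[u0 u1].
have mV : measurable_fun setT (fun w => density_cdf (X w)).
  by apply: measurableT_comp => //; exact: measurable_density_cdf.
have mF v : measurable [set w | v < density_cdf (X w)].
  rewrite (_ : [set w | _] = (fun w => density_cdf (X w)) @^-1` `]v, +oo[%classic).
    by rewrite -[X in measurable X]setTI; exact: mV.
  by apply/seteqP; split => w /=; rewrite in_itv /= andbT.
have mX c : measurable [set w | c < X w].
  rewrite (_ : [set w | _] = X @^-1` `]c, +oo[%classic).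
    by rewrite -[X in measurable X]setTI; exact: measurable_funP.
  by apply/seteqP; split => w /=; rewrite in_itv /= andbT.
have tail c : P [set w | c < X w] = (1 - density_cdf c)%:E.
  rewrite (_ : [set w | _] = ~` (X @^-1` `]-oo, c]%classic)).
    rewrite probability_setC; last first.
      by rewrite -[X in measurable X]setTI; exact: measurable_funP.
    by rewrite EFinB density_cdfE -Xf.
  by apply/seteqP; split => w /=; rewrite in_itv /= ltNge => /negP.
have fineE : P [set w | u < density_cdf (X w)] =
    (fine (P [set w | u < density_cdf (X w)]))%:E.
  by rewrite fineK // fin_num_measure.
apply/eqP; rewrite eq_le; apply/andP; split.
  case: (ltgtP 0 u) u0 => // [u0 _|<- _]; last by rewrite subr0 probability_le1.
  have [|c cu] := @density_cdf_surj u; first by rewrite u0.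
  rewrite -cu -tail; apply: le_measure; rewrite ?inE //.
  move=> w /=; apply: contraTT; rewrite -!leNgt => /density_cdf_homo.
  by rewrite cu.
rewrite fineE lee_fin; apply/ler_addgt0Pr => e e0.
(* v is between u and u + e, and less than 1 so that it is a value of F *)
pose v := Num.min (u + e) ((u + 1) / 2).
have [uv vu v1] : [/\ u < v, v <= u + e & v < 1].
  by rewrite /v lt_min ge_min gt_min; split; lra.
have [|c cv] := @density_cdf_surj v; first by apply/andP; lra.
suff : (1 - v <= fine (P [set w | u < density_cdf (X w)]))%R by lra.
rewrite -lee_fin -fineE -cv -tail; apply: le_measure; rewrite ?inE //.
move=> w /= /ltW /density_cdf_homo; rewrite cv; exact: lt_le_trans.
Qed.

(** Open right half-lines generate the Borel sets. *)
Lemma uniform01_density_cdf (V : {RV P >-> R}) :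
  (forall w, V w = density_cdf (X w)) -> uniform01 V.
Proof.
move=> VE A mA.
(* the uniform law on [0, 1], carried over to the measurable structure that
   the distribution of V uses *)
pose idR : measurableTypeR R -> R := fun y => y.
have midR : measurable_fun setT idR by move=> _ B mB; rewrite setTI.
have m01 : measurable (`[0%R, 1%R]%classic : set (measurableTypeR R)).
  exact: measurable_itv.
apply: (@measure_unique _ R R (@RGenOInfty.G R) (fun k => `]- k%:R, +oo[%classic)
  _ _ _ _ (distribution P V) (pushforward (mrestr mu m01) idR)) => //.
- exact: RGenOInfty.measurableE.
- move=> _ _ [x ->] [y ->]; exists (Num.max x y).
  by apply/seteqP; split => t /=; rewrite !in_itv /= !andbT gt_max => /andP.
- by move=> k; exists (- k%:R).
- rewrite -subTset => x _; exists (Num.bound `|x|) => //=.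
  rewrite in_itv /= andbT.
  by have := archi_boundP (normr_ge0 x); rewrite ltr_norml => /andP[].
- move=> _ [u ->].
  rewrite -[LHS]/(P (V @^-1` `]u, +oo[)) -[RHS]/(mu (`]u, +oo[ `&` `[0, 1])).
  have -> : V @^-1` `]u, +oo[ = [set w | u < density_cdf (X w)].
    by apply/seteqP; split => w /=; rewrite in_itv /= andbT VE.
  have [u0|u0] := ltP u 0.
    rewrite (_ : [set w | _] = setT); last first.
      by apply/seteqP; split => // w _ /=; rewrite (lt_le_trans u0) // density_cdf_ge0.
    rewrite probability_setT (_ : _ `&` _ = `[0, 1]%classic).
      by rewrite lebesgue_measure_itv /= lte_fin ltr01 oppr0 adde0.
    by apply/seteqP; split => t /=; rewrite !in_itv /=; lra.
  have [u1|u1] := ltP u 1.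
    rewrite density_cdf_upper_tail ?u0 //.
    rewrite (_ : _ `&` _ = `]u, 1]%classic).
      by rewrite lebesgue_measure_itv /= lte_fin u1.
    by apply/seteqP; split => t /=; rewrite !in_itv /=; lra.
  rewrite (_ : [set w | _] = set0); last first.
    apply/seteqP; split => // w /=.
    by rewrite ltNge (le_trans (density_cdf_le1 _)).
  rewrite (_ : _ `&` _ = set0) ?measure0 //.
  by apply/seteqP; split => t //=; rewrite !in_itv /=; lra.
- by move=> k; rewrite (le_lt_trans (probability_le1 _ _)) // ltry.
Qed.
End ProbabilityIntegralTransform.

(** * Log-concave functions and exponential integrals *)

Section LogConcave.
Context {R : realType}.
Variables (f : R -> R) (f_lc : log_concave f).

(** The defining inequality of concavity at b = t * a + (1 - t) * c, cleared of
    denominators.  It is stated through ln f because phi is finite exactly where f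
    is positive; all later uses of log-concavity go through this lemma. *)
Lemma log_concave_chord (a b c : R) : a < b -> b < c -> 0 < f a -> 0 < f c ->
  0 < f b /\ (c - b) * ln (f a) + (b - a) * ln (f c) <= (c - a) * ln (f b).
Proof.
move=> ab bc fa fc; have [phi [phi_noo phi_cc fE]] := f_lc.
have ac : 0 < c - a by lra.
have phiE z : 0 < f z -> phi z = (ln (f z))%:E.
  move=> fz; have := fE z; case: (phi z) (phi_noo z) => [r|//|] _ /=.
    by move=> [->]; rewrite expRK.
  by move=> [fz0]; rewrite fz0 ltxx in fz.
pose t := (c - b) / (c - a).
have t01 : 0 <= t <= 1.
  by rewrite /t divr_ge0 ?ler_pdivrMr //=; lra.
have := phi_cc a c t t01; rewrite (phiE _ fa) (phiE _ fc) -!EFinM -EFinD.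
have -> : t * a + (1 - t) * c = b by rewrite /t; field; lra.
move=> le_phi.
have fb : 0 < f b.
  rewrite -lte_fin fE; move: le_phi; case: (phi b) (phi_noo b) => [r|//|] _ //=.
  by rewrite lte_fin expR_gt0.
split=> //; move: le_phi; rewrite phiE // lee_fin => le_phi.
have -> : (c - b) * ln (f a) + (b - a) * ln (f c) =
    (c - a) * (t * ln (f a) + (1 - t) * ln (f c)) by rewrite /t; field; lra.
by rewrite ler_pM2l.
Qed.

Lemma log_concave_slope (a b c : R) : a < b -> b < c -> 0 < f a -> 0 < f c ->
  (ln (f c) - ln (f b)) / (c - b) <= (ln (f b) - ln (f a)) / (b - a).
Proof.
move=> ab bc fa fc; have [_ chord] := log_concave_chord ab bc fa fc.
by rewrite ler_pdivrMr ?subr_gt0 // mulrAC ler_pdivlMr ?subr_gt0 //; lra.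
Qed.

(** The slope is the supremum of the slopes of the chords to the right of b; the
    chord from a bounds them, and the chord to c shows that there is one. *)
Lemma log_concave_tangent (a b c : R) : a < b -> b < c -> 0 < f a -> 0 < f c ->
  exists g, forall z, f z <= expR (ln (f b) + g * (z - b)).
Proof.
move=> ab bc fa fc; have [fb _] := log_concave_chord ab bc fa fc.
have fE z : 0 < f z -> f z = expR (ln (f z)) by move=> fz; rewrite lnK.
pose slopes := [set s | exists2 z, b < z & 0 < f z /\
  s = (ln (f z) - ln (f b)) / (z - b)].
have slopes_le z s : z < b -> 0 < f z -> slopes s ->
    s <= (ln (f b) - ln (f z)) / (b - z).
  by move=> zb fz [y by_ [fy ->]]; exact: log_concave_slope.
have sup_slopes : has_sup slopes.
  split; first by exists ((ln (f c) - ln (f b)) / (c - b)), c.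
  by exists ((ln (f b) - ln (f a)) / (b - a)) => s; exact: slopes_le.
exists (sup slopes) => z.
have [fz|fz] := ltP 0 (f z); last by rewrite (le_trans fz) // expR_ge0.
rewrite [leLHS]fE // ler_expR.
have [zb|bz|<-] := ltgtP z b; last by rewrite subrr mulr0 addr0.
- have : sup slopes <= (ln (f b) - ln (f z)) / (b - z).
    by apply: ge_sup; [case: sup_slopes | move=> s; exact: slopes_le].
  by rewrite ler_pdivlMr ?subr_gt0 //; lra.
- have : (ln (f z) - ln (f b)) / (z - b) <= sup slopes.
    by apply: ub_le_sup; [case: sup_slopes | exists z].
  by rewrite ler_pdivrMr ?subr_gt0 //; lra.
Qed.

End LogConcave.

Section ExponentialIntegral.
Context {R : realType}.
Local Notation mu := (@lebesgue_measure R).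

Lemma integral_expR_affine (a b c l g : R) : a <= b -> g != 0 ->
  (\int[mu]_(z in `[a, b]) (expR (l + g * (z - c)))%:E =
   ((expR (l + g * (b - c)) - expR (l + g * (a - c))) / g)%:E)%E.
Proof.
move=> ab g0.
pose F z := g^-1 * expR (l + g * (z - c)).
have dF (z : R) : is_derive z 1 F (expR (l + g * (z - c))).
  have d1 : is_derive z 1 (fun z => l + g * (z - c)) g.
    have -> : (fun z => l + g * (z - c)) = cst l + g *: (id - cst c).
      by apply/funext => y; rewrite !fctE.
    by apply: is_derive_eq; rewrite /GRing.scale /=; ring.
  have d2 := @is_derive1_comp _ expR (fun z => l + g * (z - c)) z _ _
    (is_derive_expR _) d1.
  have -> : F = g^-1 *: (expR \o (fun z => l + g * (z - c))).
    by apply/funext => y; rewrite !fctE.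
  by apply: is_derive_eq; rewrite /GRing.scale /=; field.
have cf : continuous (fun z => expR (l + g * (z - c))).
  move=> z; apply: continuous_comp; last exact: continuous_expR.
  apply: cvgD; first exact: cvg_cst.
  by apply: cvgM; [exact: cvg_cst | apply: cvgB; [exact: cvg_id | exact: cvg_cst]].
rewrite (integral_derivative ab dF cf); congr (_%:E); rewrite /F.
by field.
Qed.

Lemma E_neq0 (s : R) : s != 0 -> E_ s = (expR s - 1) / s.
Proof.
move=> s0; rewrite /E_ /Rintegral.
under eq_integral => t _ do rewrite -[s * t]add0r -[t in s * t]subr0.
by rewrite (integral_expR_affine 0 0 ler01 s0) /= !subr0 !add0r mulr1 mulr0 expR0.
Qed.

Lemma E_0 : E_ (0 : R) = 1.
Proof.
rewrite /E_ /Rintegral.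
under eq_integral => t _ do rewrite mul0r expR0.
by rewrite integral_cst //= lebesgue_measure_itv /= lte_fin ltr01 oppr0 adde0 mule1.
Qed.

(** The two anchorings of a tangent of slope g over [a, b]: at the left end
    (right tangent) and at the right end (left tangent). *)
Lemma integral_expR_E (a b l g : R) : a < b ->
  (\int[mu]_(z in `[a, b]) (expR (l + g * (z - a)))%:E =
    (expR l * (b - a) * E_ (g * (b - a)))%:E)%E /\
  (\int[mu]_(z in `[a, b]) (expR (l + g * (z - b)))%:E =
    (expR l * (b - a) * E_ (g * (a - b)))%:E)%E.
Proof.
move=> ab; have [->|g0] := eqVneq g 0.
  rewrite !mul0r E_0 mulr1.
  have cstE c : (\int[mu]_(z in `[a, b]) (expR (l + 0 * (z - c)))%:E =
      (expR l * (b - a))%:E)%E.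
    under eq_integral do rewrite mul0r addr0.
    by rewrite integral_cst //= lebesgue_measure_itv /= lte_fin ab.
  by split; exact: cstE.
have ba : b - a != 0 by lra.
have ab0 : a - b != 0 by lra.
split; rewrite integral_expR_affine ?ltW // E_neq0 ?mulf_neq0 // subrr mulr0 addr0 expRD;
  congr (_%:E); field; rewrite ?ba ?ab0 ?g0 //.
Qed.

End ExponentialIntegral.

(** * Feasibility of the true log-density and coverage of the band *)

(** On a downward closed predicate, counting amounts to finding the last index;
    this is what the definition of [cell] relies on. *)
Lemma count_iota_initial (p : pred nat) (m : nat) :
  (forall i j, (0 < i)%N -> (i <= j <= m)%N -> p j -> p i) ->
  forall k, (0 < k <= m)%N -> p k = (k <= count p (iota 1 m))%N.
Proof.
elim: m => [|m IHm] down k; first by case: k.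
have downm i j : (0 < i)%N -> (i <= j <= m)%N -> p j -> p i.
  by move=> i0 /andP[ij jm]; apply: down; rewrite // ij ltnW.
have -> : iota 1 m.+1 = iota 1 m ++ [:: m.+1] by rewrite -(addn1 m) iotaD /= addnC.
rewrite count_cat /= addn0.
have [pm|pm] := boolP (p m.+1).
  move=> /andP[k0 km].
  have -> : count p (iota 1 m) = m.
    rewrite -[RHS](size_iota 1 m); apply/eqP; rewrite -all_count; apply/allP => i.
    rewrite mem_iota => /andP[i0 im]; apply: (down i m.+1) => //.
    by rewrite leqnn andbT ltnW // -add1n.
  by rewrite addn1 km (down k m.+1) // km leqnn.
rewrite addn0 => /andP[k0]; rewrite leq_eqVlt => /orP[/eqP->|km].
  rewrite (negbTE pm); apply/esym/negbTE; rewrite -ltnNge ltnS.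
  by rewrite -[leqRHS](size_iota 1 m) count_size.
by apply: IHm => //; rewrite k0.
Qed.

Lemma interpolation_le {R : realType} (u v z a b la lb y : R) :
  u < z -> z < v -> a <= la -> b <= lb ->
  (v - z) * la + (z - u) * lb <= (v - u) * y ->
  a + (z - u) * ((b - a) / (v - u)) <= y.
Proof.
move=> uz zv al bl chord; have D : 0 < v - u by lra.
rewrite -(ler_pM2l D); apply: le_trans chord.
have -> : (v - u) * (a + (z - u) * ((b - a) / (v - u))) =
    (v - z) * a + (z - u) * b by field; lra.
by apply: lerD; apply: ler_wpM2l => //; lra.
Qed.

Section Band.
Context {R : realType}.
Variables (alpha : R) (n : nat) (X : 'I_n -> R) (f : R -> R).
Local Notation mu := (@lebesgue_measure R).
Local Notation m := (m_ R n).
Local Notation x := (x_ X).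
Local Notation F := (density_cdf f).

Hypotheses (f_lc : log_concave f) (f_density : is_density f).
Hypothesis m_ge8 : (8 <= m)%N.
Hypothesis x_incr : forall i j, (0 < i)%N -> (i < j <= m)%N -> x i < x j.
Hypothesis fx_gt0 : forall i, (0 < i <= m)%N -> 0 < f (x i).

Let ln_f i : R := ln (f (x i)).

(** The line of slope g through (x_i, ln f (x_i)) lies above ln f.  Exponentiated, so
    that the points where f vanishes are covered. *)
Definition tangent_at (i : nat) (g : R) : Prop :=
  forall z, f z <= expR (ln_f i + g * (z - x i)).

Let mf : measurable_fun setT f. Proof. by case: f_density. Qed.
Let f0 t : 0 <= f t. Proof. by case: f_density. Qed.
Let fE i : (0 < i <= m)%N -> f (x i) = expR (ln_f i).
Proof. by move=> im; rewrite lnK // posrE fx_gt0. Qed.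

Lemma measurable_expR_affine (l g c : R) (A : set R) :
  measurable_fun A (fun z => (expR (l + g * (z - c)))%:E).
Proof.
apply/measurable_EFinP/measurable_funTS/measurableT_comp => //.
by apply: measurable_funD => //; apply: measurable_funM => //; exact: measurable_funB.
Qed.

Lemma cell_mass i : (0 < i < m)%N ->
  (F (x i.+1) - F (x i))%:E = (\int[mu]_(t in `[x i, x i.+1]) (f t)%:E)%E.
Proof.
move=> /andP[i0 im]; rewrite -density_cdfB //; last by rewrite ltW // x_incr ?leqnn.
by rewrite integral_itv_obnd_cbnd //; exact/measurable_EFinP/measurable_funTS.
Qed.

Lemma cell_mass_le_tangent i k g : (0 < i < m)%N -> tangent_at k g ->
  ((F (x i.+1) - F (x i))%:E <=
   \int[mu]_(z in `[x i, x i.+1]) (expR (ln_f k + g * (z - x k)))%:E)%E.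
Proof.
move=> im tg; rewrite cell_mass //; apply: ge0_le_integral => //=.
- by move=> z _; rewrite lee_fin.
- exact/measurable_EFinP/measurable_funTS.
- exact: measurable_expR_affine.
- by move=> z _; rewrite lee_fin.
Qed.

Section Constraints.
Variables (l g : nat -> R).
Hypothesis lE : forall i, (0 < i <= m)%N -> l i = ln_f i.
Hypothesis g_tangent : forall i, (1 < i < m)%N -> tangent_at i (g i).

Lemma cell_mass_le_right_tangent i : (1 < i < m)%N ->
  F (x i.+1) - F (x i) <= right_tangent X l g i.
Proof.
move=> /andP[i1 im].
have xi : x i < x i.+1 by apply: x_incr; lia.
have [E _] := integral_expR_E (ln_f i) (g i) xi.
rewrite -lee_fin /right_tangent lE; last by lia.
by rewrite -E; apply: cell_mass_le_tangent; [lia | apply: g_tangent; lia].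
Qed.

Lemma cell_mass_le_left_tangent i : (0 < i < m.-1)%N ->
  F (x i.+1) - F (x i) <= left_tangent X l g i.
Proof.
move=> /andP[i1 im].
have xi : x i < x i.+1 by apply: x_incr; lia.
have [_ E] := integral_expR_E (ln_f i.+1) (g i.+1) xi.
rewrite -lee_fin /left_tangent lE; last by lia.
by rewrite -E; apply: cell_mass_le_tangent; [lia | apply: g_tangent; lia].
Qed.

Lemma L_le_cell_mass i : (0 < i < m)%N -> L_ X l i <= F (x i.+1) - F (x i).
Proof.
move=> im.
have xi : x i < x i.+1 by apply: x_incr; lia.
pose s := (ln_f i.+1 - ln_f i) / (x i.+1 - x i).
have sE : s * (x i.+1 - x i) = ln_f i.+1 - ln_f i by rewrite divfK //; lra.
have [E _] := integral_expR_E (ln_f i) s xi.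
rewrite -lee_fin cell_mass // /L_ !lE; try lia.
rewrite -sE [(_ - _) * expR _]mulrC -E; apply: ge0_le_integral => //=.
- exact: measurable_expR_affine.
- exact/measurable_EFinP/measurable_funTS.
move=> z; rewrite in_itv /= => /andP[xz zx]; rewrite lee_fin.
have fi : 0 < f (x i) by apply: fx_gt0; lia.
have fi1 : 0 < f (x i.+1) by apply: fx_gt0; lia.
move: xz; rewrite le_eqVlt => /orP[/eqP<-|xz].
  by rewrite subrr mulr0 addr0 lnK.
move: zx; rewrite le_eqVlt => /orP[/eqP->|zx].
  by rewrite sE addrC subrK lnK.
have [fz chord] := log_concave_chord f_lc xz zx fi fi1.
rewrite -[leRHS]lnK // ler_expR -/(ln_f _) -(ler_pM2l (_ : 0 < x i.+1 - x i)); last by lra.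
apply: le_trans chord; rewrite le_eqVlt; apply/orP; left; apply/eqP.
rewrite mulrDr mulrA [_ * s]mulrC sE /ln_f; ring.
Qed.

Lemma cell_mass_le_U i : (0 < i < m)%N -> F (x i.+1) - F (x i) <= U_ X l g i.
Proof.
move=> im; rewrite /U_; case: eqP => [ie|ie].
  by apply: cell_mass_le_right_tangent; lia.
by apply: cell_mass_le_left_tangent; lia.
Qed.

Lemma cell_mass_le_V i : (0 < i < m)%N -> F (x i.+1) - F (x i) <= V_ X l g i.
Proof.
move=> im; rewrite /V_; case: eqP => [ie|ie].
  by apply: cell_mass_le_left_tangent; lia.
by apply: cell_mass_le_right_tangent; lia.
Qed.

Hypothesis spacings : forall B, (B <= Bmax R n)%N -> forall jk, I_ R n B jk ->
  [/\ (0 < jk.1)%N, (jk.1 <= jk.2 <= m)%N &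
      c_ n alpha B <= F (x jk.2) - F (x jk.1) <= d_ n alpha B].

(** Only l_1, ..., l_m and g_2, ..., g_(m-1) enter the constraints, and each U_i and
    V_i uses the tangent at an endpoint of the cell which is not x_1 or x_m. *)
Lemma true_log_density_constraints : constraints alpha X l g.
Proof.
split=> [i j im ij|B BB [j k] jkI].
  have := g_tangent (i := i); rewrite /tangent_at.
  move=> /(_ _ (x j)); rewrite !lE; try lia.
  rewrite fE; last by lia.
  by rewrite ler_expR; apply; lia.
have /= [j0 /andP[jk km] /andP[cF Fd]] := spacings BB jkI.
have massE : F (x k) - F (x j) = \sum_(j <= i < k) (F (x i.+1) - F (x i)).
  by rewrite telescope_sumr.
split; rewrite /C2 /C3 /C4 /=.
- rewrite (le_trans cF) // massE; apply: ler_sum_nat => i ijk.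
  by apply: cell_mass_le_U => //; lia.
- rewrite (le_trans cF) // massE; apply: ler_sum_nat => i ijk.
  by apply: cell_mass_le_V => //; lia.
- rewrite (le_trans _ Fd) // massE; apply: ler_sum_nat => i ijk.
  by apply: L_le_cell_mass => //; lia.
Qed.

End Constraints.

Hypothesis spacings : forall B, (B <= Bmax R n)%N -> forall jk, I_ R n B jk ->
  [/\ (0 < jk.1)%N, (jk.1 <= jk.2 <= m)%N &
      c_ n alpha B <= F (x jk.2) - F (x jk.1) <= d_ n alpha B].

Lemma true_log_density_feasible : exists2 lg, feasible alpha X lg &
  forall i, (0 < i <= m)%N -> entry lg.1 i = ln_f i.
Proof.
have /choice[g gP] : forall i, exists g, (1 < i < m)%N -> tangent_at i g.
  move=> i; have [/andP[i1 im]|_] := boolP (1 < i < m)%N; last by exists 0.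
  have [|||| g] := @log_concave_tangent R f f_lc (x i.-1) (x i) (x i.+1).
  - by apply: x_incr; lia.
  - by apply: x_incr; lia.
  - by apply: fx_gt0; lia.
  - by apply: fx_gt0; lia.
  - by exists g.
have lP i : (0 < i <= m)%N ->
    entry (mkseq (fun k => ln_f k.+1) m) i = ln_f i.
  by case: i => // i im; rewrite /entry nth_mkseq.
exists ([tuple of mkseq (fun k => ln_f k.+1) m],
        [tuple of mkseq (fun k => g k.+1) m.-1]) => //=.
apply: true_log_density_constraints => // i im.
have -> : entry (mkseq (fun k => g k.+1) m.-1) i = g i.
  by rewrite /entry nth_mkseq ?prednK //; lia.
exact: gP.
Qed.

Lemma feasible_neq0 : `[< feasible alpha X = set0 >] = false.
Proof.
have [lg lgP _] := true_log_density_feasible.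
by apply/asboolPn => fe; rewrite fe in lgP.
Qed.

Lemma lower_knot_le i : (0 < i <= m)%N -> (lower_knot alpha X i <= (ln_f i)%:E)%E.
Proof.
move=> im; have [lg lgP lgE] := true_log_density_feasible.
by apply: ereal_inf_lbound; exists lg => //; rewrite lgE.
Qed.

Lemma upper_knot_ge i : (0 < i <= m)%N -> ((ln_f i)%:E <= upper_knot alpha X i)%E.
Proof.
move=> im; have [lg lgP lgE] := true_log_density_feasible.
by apply: ereal_sup_ubound; exists lg => //; rewrite lgE.
Qed.

Lemma cell_le z : (cell X z <= m)%N.
Proof. by rewrite -[leqRHS](size_iota 1 m) count_size. Qed.

Lemma cellP z i : (0 < i <= m)%N -> (x i <= z) = (i <= cell X z)%N.
Proof.
apply: count_iota_initial => j k j0 /andP[jk km] xz.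
move: jk; rewrite leq_eqVlt => /orP[/eqP->//|jk].
by apply: le_trans xz; rewrite ltW // x_incr ?jk.
Qed.

(** Each quotient in the maximum is at most the slope of the chord of ln f from x_k to
    x_j, which by concavity is at most the slope of the chord from z to x_k. *)
Lemma slopeR_le k z : (0 < k < m)%N -> z < x k -> 0 < f z ->
  (slopeR alpha X k <= ((ln_f k - ln (f z)) / (x k - z))%:E)%E.
Proof.
move=> km zx fz; rewrite /slopeR big_nat; apply: (big_ind (fun s => s <= _)%E).
- exact: leNye.
- by move=> s t ss st; rewrite ge_max ss.
move=> j kj; have xkj : x k < x j by apply: x_incr; lia.
have fj : 0 < f (x j) by apply: fx_gt0; lia.
apply: (@le_trans _ _ ((ln_f j - ln_f k) / (x j - x k))%:E).
  rewrite EFinM; apply: lee_wpmul2r; first by rewrite lee_fin invr_ge0; lra.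
  by rewrite EFinB; apply: leeB; [apply: lower_knot_le | apply: upper_knot_ge]; lia.
by rewrite lee_fin; exact: log_concave_slope.
Qed.

Lemma slopeL_ge k z : (1 < k <= m)%N -> x k < z -> 0 < f z ->
  (((ln (f z) - ln_f k) / (z - x k))%:E <= slopeL alpha X k)%E.
Proof.
move=> km zx fz; rewrite /slopeL big_nat; apply: (big_ind (fun s => _ <= s)%E).
- exact: leey.
- by move=> s t ss st; rewrite le_min ss.
move=> j kj; have xkj : x j < x k by apply: x_incr; lia.
have fj : 0 < f (x j) by apply: fx_gt0; lia.
apply: (@le_trans _ _ ((ln_f k - ln_f j) / (x k - x j))%:E).
  by rewrite lee_fin; exact: log_concave_slope.
rewrite EFinM; apply: lee_wpmul2r; first by rewrite lee_fin invr_ge0; lra.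
by rewrite EFinB; apply: leeB; [apply: upper_knot_ge | apply: lower_knot_le]; lia.
Qed.

(** To the left of x_k the factor z - x_k is negative, so an upper bound on the slope
    is a lower bound on the line; infinite values of the knot bounds only raise
    it. *)
Lemma le_lineR k z : (0 < k < m)%N -> z <= x k ->
  ((f z)%:E <= expeR (lineR alpha X k z))%E.
Proof.
move=> km zx; have [fz|fz] := ltP 0 (f z); last first.
  by rewrite (@le_trans _ _ 0%E) ?lee_fin ?expeR_ge0.
rewrite -[f z]lnK // -[(expR _)%:E]/(expeR (ln (f z))%:E) ler_expeR /lineR.
have upk := upper_knot_ge (i := k).
move: zx; rewrite le_eqVlt => /orP[/eqP zx|zx].
  by rewrite zx subrr mule0 adde0; apply: upk; lia.
have slope := slopeR_le km zx fz.
rewrite -[ln (f z)](subrKC (ln_f k)) EFinD leeD //; first by apply: upk; lia.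
have -> : ln (f z) - ln_f k = (ln_f k - ln (f z)) / (x k - z) * (z - x k).
  by field; lra.
rewrite EFinM -leeN2 -!muleN -EFinN.
by apply: lee_wpmul2r => //; rewrite lee_fin; lra.
Qed.

Lemma le_lineL k z : (1 < k <= m)%N -> x k <= z ->
  ((f z)%:E <= expeR (lineL alpha X k z))%E.
Proof.
move=> km zx; have [fz|fz] := ltP 0 (f z); last first.
  by rewrite (@le_trans _ _ 0%E) ?lee_fin ?expeR_ge0.
rewrite -[f z]lnK // -[(expR _)%:E]/(expeR (ln (f z))%:E) ler_expeR /lineL.
have upk := upper_knot_ge (i := k).
move: zx; rewrite le_eqVlt => /orP[/eqP zx|zx].
  by rewrite -zx subrr mule0 adde0; apply: upk; lia.
have slope := slopeL_ge km zx fz.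
rewrite -[ln (f z)](subrKC (ln_f k)) EFinD leeD //; first by apply: upk; lia.
have -> : ln (f z) - ln_f k = (ln (f z) - ln_f k) / (z - x k) * (z - x k).
  by field; lra.
rewrite EFinM; apply: lee_wpmul2r => //; rewrite lee_fin; lra.
Qed.

Lemma le_upper_band z : ((f z)%:E <= expeR (upper_band alpha X z))%E.
Proof.
have cz := cell_le z; rewrite /upper_band feasible_neq0.
have xc i : (0 < i <= m)%N -> (i <= cell X z)%N -> x i <= z.
  by move=> im; rewrite cellP.
have cx i : (0 < i <= m)%N -> (cell X z < i)%N -> z <= x i.
  by move=> im ci; rewrite ltW // ltNge cellP // -ltnNge.
case: eqP => [c0|c0]; first by apply: le_lineR; [lia | apply: cx; lia].
case: eqP => [c1|c1].
  case: eqP => [zx|_]; last by apply: le_lineR; [lia | apply: cx; lia].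
  rewrite zx fE -?[(expR _)%:E]/(expeR (ln_f 1)%:E) ?ler_expeR; last by lia.
  by apply: upper_knot_ge; lia.
case: ifP => cm; last by apply: le_lineL; [lia | apply: xc; lia].
have lL : ((f z)%:E <= expeR (lineL alpha X (cell X z) z))%E.
  by apply: le_lineL; [lia | apply: xc; lia].
have lR : ((f z)%:E <= expeR (lineR alpha X (cell X z).+1 z))%E.
  by apply: le_lineR; [lia | apply: cx; lia].
by rewrite /mine /Order.min; case: ifP.
Qed.

Lemma lower_band_le z : (expeR (lower_band alpha X z) <= (f z)%:E)%E.
Proof.
have cz := cell_le z; rewrite /lower_band feasible_neq0.
have triv : (expeR -oo <= (f z)%:E)%E by rewrite /= lee_fin.
case: eqP => [//|c0].
case: eqP => [zx|zx].
  rewrite [f z](_ : _ = expR (ln_f (cell X z))); last by rewrite -fE -?zx //; lia.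
  rewrite -[(expR _)%:E]/(expeR (ln_f _)%:E) ler_expeR.
  by apply: lower_knot_le; lia.
case: eqP => [//|cm]; case: ifPn => [//|].
set i := cell X z in c0 cm zx cz *.
have xz : x i < z.
  by rewrite lt_neqAle cellP ?leqnn; [rewrite andbT; apply/eqP => e; apply: zx | lia].
have zx' : z < x i.+1 by rewrite ltNge cellP ?ltnn //; lia.
have : (lower_knot alpha X i <= (ln_f i)%:E)%E by apply: lower_knot_le; lia.
have : (lower_knot alpha X i.+1 <= (ln_f i.+1)%:E)%E by apply: lower_knot_le; lia.
case: (lower_knot alpha X i) => [a| |]; case: (lower_knot alpha X i.+1) => [b| |] //=;
  rewrite ?lee_fin ?leye_eq //.
move=> bl al _.
have fi : 0 < f (x i) by apply: fx_gt0; lia.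
have fi1 : 0 < f (x i.+1) by apply: fx_gt0; lia.
have [fz chord] := log_concave_chord f_lc xz zx' fi fi1.
rewrite -[leRHS]lnK // ler_expR.
exact: interpolation_le chord.
Qed.

End Band.

(** * Beta quantiles, levels and the union bound *)

Section Quantiles.
Context {R : realType}.

Lemma continuous_binomial_tail (n r : nat) (y : R) :
  continuous (binomial_tail n r y).
Proof.
elim: r => [|r IHr] u.
  have -> : binomial_tail n 0 y = cst 0.
    by apply/funext => v; rewrite /binomial_tail big_ord0.
  exact: cvg_cst.
have -> : binomial_tail n r.+1 y = fun v => binomial_tail n r y v +
    'C(n, r)%:R * (v ^+ r * (y - v) ^+ (n - r)).
  by apply/funext => v; rewrite /binomial_tail big_ord_recr.
apply: cvgD; first exact: IHr.
by apply: cvgM; [exact: cvg_cst | exact: continuous_binomial_term].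
Qed.

(** The beta distribution function is continuous, so it takes the value gamma at the
    gamma-quantile; continuity is read off from the polynomial expression of the
    tail. *)
Lemma qBeta_tail (gamma : R) (n r : nat) : 0 < gamma < 1 -> (0 < r <= n)%N ->
  let c := qBeta gamma r (n + 1 - r) in
  0 <= c <= 1 /\ binomial_tail n r 1 c = 1 - gamma.
Proof.
move=> /andP[g0 g1] rn c; have /andP[r0 rlen] := rn.
pose beta := @beta_prob R r (n + 1 - r).
pose S := [set x : R | (gamma%:E <= beta `]-oo, x]%classic)%E].
have SE x : 0 <= x <= 1 -> S x <-> binomial_tail n r 1 x <= 1 - gamma.
  move=> x01.
  have -> : S x = (gamma <= 1 - binomial_tail n r 1 x) :> Prop.
    rewrite -[S x]/(is_true (gamma%:E <= beta `]-oo, x]%classic)%E) -setCitvr.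
    have -> : beta (~` `]x, +oo[%classic) = (1 - beta `]x, +oo[%classic)%E.
      exact: probability_setC.
    have -> : beta `]x, +oo[%classic = (binomial_tail n r 1 x)%:E.
      exact: beta_prob_tail.
    by rewrite lee_fin.
  by split; lra.
have h0 : binomial_tail n r 1 (0 : R) = 1.
  by case: r r0 {rn rlen c beta S SE} => // r _; rewrite binomial_tail0 expr1n.
have h1 : binomial_tail n r 1 (1 : R) = 0 by exact: binomial_tail_diag.
have S1 : S 1 by apply/SE; rewrite ?h1; lra.
have S_ge0 x : S x -> 0 <= x.
  move=> Sx; rewrite leNgt; apply/negP => x0; move: Sx; apply/negP; rewrite -ltNge.
  apply: (@le_lt_trans _ _ (beta (~` `[0, 1]%classic))); last first.
    have -> : beta (~` `[0, 1]%classic) = (1 - beta `[0%R, 1%R]%classic)%E.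
      exact: probability_setC.
    have -> : beta `[0%R, 1%R]%classic = 1%E by exact: beta_prob01.
    by rewrite subee // lte_fin.
  apply: le_measure; rewrite ?inE //; first exact: measurableC.
  by move=> y /=; rewrite !in_itv /= => yx; apply/negP; lra.
have infS : has_inf S by split; [exists 1 | exists 0].
have cE : c = inf S by [].
have c0 : 0 <= c by rewrite cE; apply: lb_le_inf; [exists 1 | exact: S_ge0].
have c1 : c <= 1 by rewrite cE; apply: ge_inf => //; case: infS.
split; first by rewrite c0 c1.
have hc : {for c, continuous (binomial_tail n r 1)} by exact: continuous_binomial_tail.
apply/eqP; rewrite eq_le; apply/andP; split; rewrite leNgt; apply/negP => lt_h.
  have /nbhs_ballP[e /= e0 he] : nbhs c [set x | 1 - gamma < binomial_tail n r 1 x].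
    by apply: (cvgr_gt _ hc).
  have [s Ss sce] := inf_adherent e0 infS.
  have cs : c <= s by rewrite cE; apply: ge_inf => //; case: infS.
  have Smin : S (Num.min s 1) by rewrite /Num.min; case: ifP.
  have cmin : c <= Num.min s 1 by rewrite le_min cs c1.
  have mins : Num.min s 1 <= s by rewrite ge_min lexx.
  have min1 : Num.min s 1 <= 1 by rewrite ge_min lexx orbT.
  have : binomial_tail n r 1 (Num.min s 1) <= 1 - gamma by apply/SE => //; lra.
  apply/negP; rewrite -ltNge; apply: he; rewrite /ball /= -/c in sce *.
  by rewrite ltr_norml; apply/andP; split; lra.
have /nbhs_ballP[e /= e0 he] : nbhs c [set x | binomial_tail n r 1 x < 1 - gamma].
  by apply: (cvgr_lt _ hc).
have {}c0 : 0 < c.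
  rewrite lt_neqAle c0 andbT; apply/eqP => c0'; rewrite -c0' h0 in lt_h; lra.
have [s [s0 sc ces]] : exists s, [/\ 0 <= s, s < c & c - e < s].
  have [ce|ce] := leP c (e / 2); first by exists 0; split; lra.
  by exists (c - e / 2); split; lra.
have Ss : S s.
  apply/SE; first by lra.
  by apply/ltW/he; rewrite /ball /= ltr_norml; apply/andP; split; lra.
have : c <= s by rewrite cE; apply: ge_inf => //; case: infS.
lra.
Qed.

End Quantiles.

Section UnionBound.
Context {R : realType} {d : measure_display} {T : measurableType d}.
Variable P : probability T R.

Lemma union_bound (I : eqType) (s : seq I) (F : I -> set T) :
  (forall i, measurable (F i)) ->
  measurable [set w | exists2 i, i \in s & F i w] /\
  (P [set w | exists2 i, i \in s & F i w] <= \sum_(i <- s) P (F i))%E.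
Proof.
move=> mF; elim: s => [|i s [mU PU]].
  rewrite big_nil (_ : [set w | _] = set0) ?measure0 //.
  by apply/seteqP; split => w // -[].
have -> : [set w | exists2 j, j \in i :: s & F j w] =
    F i `|` [set w | exists2 j, j \in s & F j w].
  apply/seteqP; split => w /=.
    by move=> [j]; rewrite inE => /predU1P[->|js] Fj; [left | right; exists j].
  by move=> [Fi|[j js Fj]]; [exists i | exists j]; rewrite ?inE ?eqxx ?js ?orbT.
split; first exact: measurableU.
rewrite big_cons; apply: le_trans (leeD (lexx _) PU).
exact: measureU2.
Qed.

End UnionBound.

Section Constants.
Context (R : realType) (n : nat).

(** 0 <= BmaxZ means 8 * 2 ^ s_n <= n. *)
Lemma m_ge8 : (1 < n)%N -> 0 <= BmaxZ R n -> (8 <= m_ R n)%N.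
Proof.
move=> n1; rewrite /BmaxZ subr_ge0 real_floor_ge_int ?num_real //; set s := s_ R n.
have n0 : (0 : R) < n%:R by rewrite ltr0n; lia.
have ln20 : (0 : R) < ln 2 by rewrite ln_gt0 // ltr1n.
rewrite /log2 ler_pdivlMr // -[s%:~R]/(s%:R : R).
have -> : s%:R * ln 2 = ln (2 ^+ s) :> R by rewrite lnXn // -[RHS]mulr_natl.
have n8 : 0 < n%:R / 8 :> R by rewrite divr_gt0.
rewrite ler_ln ?posrE ?exprn_gt0 // ler_pdivlMr ?ltr0n //.
rewrite -natrX -natrM ler_nat => sn.
rewrite /m_ -/s ltnS leq_divRL ?expn_gt0 //; lia.
Qed.

(** Scale B contributes alpha / ((B + 2) t_n), and t_n is the sum of the 1 / (B + 2).
    For n_B = 0 the inner sum is empty. *)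
Lemma level_sum_le (alpha : R) : 0 < alpha ->
  \sum_(0 <= B < (Bmax R n).+1) \sum_(1 <= k < (n_ R n B).+1)
     (level n alpha B + level n alpha B) <= alpha.
Proof.
move=> a0.
have t0 : 0 < t_ R n.
  rewrite /t_ big_nat_recl //; apply: ltr_pwDl; first by rewrite invr_gt0 ltr0n.
  by apply: sumr_ge0 => i _; rewrite invr_ge0.
apply: (@le_trans _ _ (\sum_(0 <= B < (Bmax R n).+1) alpha / t_ R n * (B + 2)%:R^-1)).
  apply: ler_sum => B _; rewrite sumr_const_nat subn1 /= /level.
  case: (n_ R n B) => [|k].
    by rewrite mulr0n mulr_ge0 ?divr_ge0 ?invr_ge0 // ltW.
  rewrite le_eqVlt; apply/orP; left; apply/eqP.
  rewrite -[LHS]mulr_natl; field.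
  have B0 := ler0n R B; have k0 := ler0n R k.
  by apply/and3P; split; rewrite gt_eqF //; lra.
by rewrite -mulr_sumr -/(t_ R n) divfK // gt_eqF.
Qed.

Lemma level_itv (alpha : R) B : 0 < alpha < 1 -> (0 < n_ R n B)%N ->
  0 < level n alpha B < 1.
Proof.
move=> /andP[a0 a1] nB.
have t1 : 1 <= 2 * t_ R n.
  rewrite /t_ big_nat_recl // mulrDr /= add0n mulfV ?lerDl //.
  by rewrite mulr_ge0 // sumr_ge0.
have nB1 : 1 <= (n_ R n B)%:R :> R by rewrite ler1n.
have B2 : 1 <= (B + 2)%:R :> R by rewrite ler1n; lia.
have D1 : 1 <= 2 * (B + 2)%:R * (n_ R n B)%:R * t_ R n.
  have -> : 2 * (B + 2)%:R * (n_ R n B)%:R * t_ R n =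
    (B + 2)%:R * (n_ R n B)%:R * (2 * t_ R n) by ring.
  by rewrite -[leLHS]mulr1 ler_pM // -[leLHS]mulr1 ler_pM.
rewrite /level divr_gt0 ?ltr_pdivrMr //; lra.
Qed.

End Constants.

(** * Order statistics of the sample and coverage probability *)

Section Sample.
Context (R : realType) (n : nat).
Local Notation m := (m_ R n).
Local Notation s := (s_ R n).

(** Scale B compares order statistics whose ranks differ by 2 ^ (B + s_n); its k-th
    spacing starts at the rank below, counted from 0. *)
Definition spacing_width (B : nat) : nat := 2 ^ (B + s).
Definition spacing_start (B k : nat) : nat := (k - 1) * spacing_width B.
Definition spacing (u : 'I_n -> R) (B k : nat) : R :=
  (sort <=%R (codom u))`_(spacing_start B k + spacing_width B) -
  (sort <=%R (codom u))`_(spacing_start B k).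

(** Ties created by [F] are harmless: both sides are sorted lists with the same
multiset of entries. *)
Lemma sort_map_homo (F : R -> R) (y : 'I_n -> R) : {homo F : a b / a <= b} ->
  map F (sort <=%R (codom y)) = sort <=%R (codom (F \o y)).
Proof.
move=> Fhomo; apply: (sorted_eq le_trans le_anti).
- by apply: (homo_sorted (e := <=%R)) => //; exact: (sort_sorted le_total).
- exact: (sort_sorted le_total).
- rewrite perm_sym perm_sort codomE map_comp -codomE.
  by apply: perm_map; rewrite perm_sym perm_sort.
Qed.

Section Order.
Variables (y : 'I_n -> R) (F : R -> R).
Hypotheses (F_homo : {homo F : a b / a <= b}) (F_inj : injective (F \o y)).
Local Notation u := (sort <=%R (codom (F \o y))).

Lemma knot_index i : (0 < n)%N -> (0 < i <= m)%N -> ((i - 1) * 2 ^ s < n)%N.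
Proof.
move=> n0; rewrite /m_ => /andP[i0 im].
have := leq_trunc_div (n - 1) (2 ^ s).
have : ((i - 1) * 2 ^ s <= ((n - 1) %/ 2 ^ s) * 2 ^ s)%N by rewrite leq_mul2r; lia.
by lia.
Qed.

Lemma F_knot i : (0 < n)%N -> (0 < i <= m)%N ->
  F (x_ y i) = u`_((i - 1) * 2 ^ s).
Proof.
move=> n0 im; have := knot_index n0 im => idx.
rewrite /x_ /order_stat /entry add1n /= -sort_map_homo // (nth_map 0) //.
by rewrite size_sort size_codom card_ord.
Qed.

Lemma knot_codom i : (0 < n)%N -> (0 < i <= m)%N -> exists k, x_ y i = y k.
Proof.
move=> n0 im; have := knot_index n0 im => idx.
apply/codomP; rewrite -(mem_sort <=%R) /x_ /order_stat /entry add1n /=.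
by rewrite mem_nth // size_sort size_codom card_ord.
Qed.

Lemma knot_incr i j : (0 < n)%N -> (0 < i)%N -> (i < j <= m)%N ->
  x_ y i < x_ y j.
Proof.
move=> n0 i0 /andP[ij jm].
suff : F (x_ y i) < F (x_ y j).
  by rewrite !ltNge; apply: contra => /F_homo.
have su : sorted <%R u.
  rewrite lt_sorted_uniq_le (sort_sorted le_total) andbT sort_uniq.
  by apply/dinjectiveP => a b _ _; exact: F_inj.
rewrite !F_knot //; try lia.
apply: (sorted_ltn_nth lt_trans) => //; rewrite ?inE.
- by rewrite size_sort size_codom card_ord knot_index //; lia.
- by rewrite size_sort size_codom card_ord knot_index //; lia.
- by rewrite ltn_mul2r expn_gt0 /=; lia.
Qed.

End Order.

Lemma scale_ranks B k : (0 < k <= n_ R n B)%N ->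
  [/\ (0 < spacing_width B <= n)%N, (spacing_start B k + spacing_width B < n)%N,
      ((k - 1) * 2 ^ B * 2 ^ s = spacing_start B k)%N &
      (k * 2 ^ B * 2 ^ s = spacing_start B k + spacing_width B)%N].
Proof.
move=> kB; rewrite /spacing_start /spacing_width.
have r0 : (0 < 2 ^ (B + s))%N by rewrite expn_gt0.
have kr : ((k - 1) * 2 ^ (B + s) + 2 ^ (B + s) = k * 2 ^ (B + s))%N.
  by rewrite mulnBl mul1n subnK // leq_pmull; lia.
have krn : (k * 2 ^ (B + s) <= n - 1)%N.
  apply: leq_trans (leq_trunc_div (n - 1) (2 ^ (B + s))).
  by rewrite leq_mul2r orbC; have := kB; rewrite /n_; lia.
by rewrite kr -!mulnA -!expnD; split=> //; lia.
Qed.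

Lemma band_covers (alpha : R) (f : R -> R) (y : 'I_n -> R) :
  (8 <= m)%N -> log_concave f -> is_density f ->
  injective (density_cdf f \o y) -> (forall i, 0 < f (y i)) ->
  (forall B k, (B <= Bmax R n)%N -> (0 < k <= n_ R n B)%N ->
    c_ n alpha B <= spacing (density_cdf f \o y) B k <= d_ n alpha B) ->
  forall z, (expeR (lower_band alpha y z) <= (f z)%:E)%E /\
            ((f z)%:E <= expeR (upper_band alpha y z))%E.
Proof.
move=> m8 f_lc f_density inj_u fy_gt0 spacings.
have F_homo := density_cdf_homo f_density.
have n0 : (0 < n)%N.
  by rewrite lt0n; apply: contraTneq m8 => ->; rewrite /m_ div0n.
have incr i j : (0 < i)%N -> (i < j <= m)%N -> x_ y i < x_ y j.
  by apply: (knot_incr F_homo inj_u).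
have fx i : (0 < i <= m)%N -> 0 < f (x_ y i).
  by move=> im; case: (knot_codom y n0 im) => a ->; exact: fy_gt0.
have knot_spacings B : (B <= Bmax R n)%N -> forall jk, I_ R n B jk ->
    [/\ (0 < jk.1)%N, (jk.1 <= jk.2 <= m)%N &
     c_ n alpha B <= density_cdf f (x_ y jk.2) - density_cdf f (x_ y jk.1)
       <= d_ n alpha B].
  move=> BB jk [k /= kB <-] /=; have [_ prn pE prE] := scale_ranks kB.
  have km : (1 + k * 2 ^ B <= m)%N.
    by rewrite /m_ add1n ltnS leq_divRL ?expn_gt0 // prE; lia.
  have jk' : (1 + (k - 1) * 2 ^ B <= 1 + k * 2 ^ B)%N.
    by rewrite leq_add2l leq_mul2r leq_subr orbT.
  have j_knot : (0 < 1 + (k - 1) * 2 ^ B <= m)%N by rewrite (leq_trans jk' km).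
  have k_knot : (0 < 1 + k * 2 ^ B <= m)%N by rewrite km.
  split=> //; first by rewrite jk' km.
  rewrite (F_knot y F_homo n0 j_knot) (F_knot y F_homo n0 k_knot) !addKn pE prE.
  exact: spacings.
by move=> z; split; [apply: lower_band_le | apply: le_upper_band].
Qed.

End Sample.

Section BadEvents.
Context {R : realType} {d : measure_display} {T : measurableType d}.
Variables (P : probability T R) (n : nat) (U : 'I_n -> {RV P >-> R}) (alpha : R).
Hypotheses (indep : mutually_independent U) (unif : forall i, uniform01 (U i)).
Hypothesis alpha_01 : 0 < alpha < 1.

(** Up to a null event, the complement of [c_B <= spacing <= d_B]. *)
Definition bad_spacing (Bk : nat * nat) : set T :=
  let E := spacing_event U (spacing_start R n Bk.1 Bk.2) (spacing_width R n Bk.1) in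
  ~` E (c_ n alpha Bk.1) `|` E (d_ n alpha Bk.1).

Lemma measurable_bad_spacing Bk : measurable (bad_spacing Bk).
Proof.
apply: measurableU; last exact: measurable_spacing_event.
by apply: measurableC; exact: measurable_spacing_event.
Qed.

Lemma scale_quantiles B k : (0 < k <= n_ R n B)%N ->
  [/\ 0 <= c_ n alpha B <= 1, 0 <= d_ n alpha B <= 1,
      binomial_tail n (spacing_width R n B) 1 (c_ n alpha B) = 1 - level n alpha B &
      binomial_tail n (spacing_width R n B) 1 (d_ n alpha B) = level n alpha B].
Proof.
move=> kB; have [rB _ _ _] := scale_ranks kB.
have lev : 0 < level n alpha B < 1 by apply: level_itv => //; lia.
have [c01 tail_c] := qBeta_tail lev rB.
have lev' : 0 < 1 - level n alpha B < 1 by lra.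
have [d01 tail_d] := qBeta_tail lev' rB.
by split=> //; rewrite tail_d subKr.
Qed.

Lemma bad_spacing_probability B k : (0 < k <= n_ R n B)%N ->
  (P (bad_spacing (B, k)) <= (level n alpha B + level n alpha B)%:E)%E.
Proof.
move=> kB; have [c01 d01 tail_c tail_d] := scale_quantiles kB.
have [_ prn _ _] := scale_ranks kB.
have mE x : measurable
    (spacing_event U (spacing_start R n B k) (spacing_width R n B) x).
  exact: measurable_spacing_event.
apply: le_trans (measureU2 P (measurableC (mE _)) (mE _)) _ => /=.
rewrite EFinD probability_setC //.
rewrite !spacing_probability ?card_ord // tail_c tail_d.
by rewrite -EFinB subKr.
Qed.

Lemma good_spacing B k w : injective (fun i => U i w) ->
  (0 < k <= n_ R n B)%N -> ~ bad_spacing (B, k) w ->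
  c_ n alpha B <= spacing (fun i => U i w) B k <= d_ n alpha B.
Proof.
move=> inj_u kB good; rewrite /spacing; set u := sort _ _.
have [/andP[c0 _] /andP[d0 _] _ _] := scale_quantiles kB.
have [_ prn _ _] := scale_ranks kB.
have spP (x : R) : 0 <= x ->
    spacing_event U (spacing_start R n B k) (spacing_width R n B) x w <->
    u`_(spacing_start R n B k) + x <
    u`_(spacing_start R n B k + spacing_width R n B).
  by move=> x0; apply: (spacing_patternP inj_u x0); rewrite card_ord.
have [nEc nEd] : ~ ~ spacing_event U (spacing_start R n B k)
    (spacing_width R n B) (c_ n alpha B) w /\
    ~ spacing_event U (spacing_start R n B k)
    (spacing_width R n B) (d_ n alpha B) w.
  by split=> h; apply: good; [left | right].
move: nEc => /contrapT /(spP _ c0) Ec.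
apply/andP; split; first by lra.
by rewrite lerBlDl leNgt; apply/negP => /(spP _ d0).
Qed.

End BadEvents.

Theorem proposition2 (R : realType) (d : measure_display)
    (T : measurableType d) (P : probability T R)
    (n : nat) (n_gt1 : (1 < n)%N) (Bmax_ge0 : 0 <= BmaxZ R n)
    (alpha : R) (alpha_01 : 0 < alpha < 1)
    (f : R -> R) (f_logconcave : log_concave f) (f_density : is_density f)
    (X : 'I_n -> {RV P >-> R}) (X_iid : iid_with_density X f) :
  probability_at_least P
    [set w | forall x : R,
       (expeR (lower_band alpha (fun i => X i w) x) <= (f x)%:E)%E /\
       ((f x)%:E <= expeR (upper_band alpha (fun i => X i w) x))%E]
    (1 - alpha).
Proof.
have [X_indep Xf] := X_iid; have /andP[alpha0 _] := alpha_01.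
have mF : measurable_fun setT (density_cdf f) := measurable_density_cdf f_density.
pose F : {mfun R >-> R} := HB.pack (density_cdf f)
  (isMeasurableFun.Build _ _ _ _ (density_cdf f) mF).
pose U i : {RV P >-> R} := [the {RV P >-> R} of F \o X i].
have U_indep : mutually_independent U.
  move=> J A mA.
  have mFA i : measurable (density_cdf f @^-1` A i).
    rewrite -[X in measurable X]setTI.
    exact: (measurable_density_cdf f_density measurableT (mA i)).
  by have := X_indep J _ mFA.
have U_unif i : uniform01 (U i).
  by apply: (@uniform01_density_cdf _ _ f_density _ _ P (X i) (Xf i)) => w.
have mbad := measurable_bad_spacing U alpha.
pose bad_tie (ij : 'I_n * 'I_n) :=
  if ij.1 == ij.2 then set0 else [set w | U ij.1 w = U ij.2 w].
pose bad_zero (i : 'I_n) := [set w | f (X i w) <= 0].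
have mbad_tie ij : measurable (bad_tie ij).
  rewrite /bad_tie; case: eqP => // _.
  rewrite (_ : [set w | _] = (fun w => U ij.1 w == U ij.2 w) @^-1` [set true]).
    rewrite -[X in measurable X]setTI.
    by apply: (measurable_fun_eqr (measurable_funP (U ij.1))
      (measurable_funP (U ij.2)) measurableT).
  by apply/seteqP; split => w /= /eqP.
have mzero : measurable [set y | f y <= 0].
  have [mf _ _] := f_density.
  rewrite (_ : [set y | _] = f @^-1` `]-oo, 0]%classic).
    by rewrite -[X in measurable X]setTI; apply: mf.
  by apply/seteqP; split => y /=; rewrite in_itv.
have mbad_zero i : measurable (bad_zero i).
  exact: (measurable_funPTI (X i) mzero).
have P_tie ij : P (bad_tie ij) = 0%E.
  rewrite /bad_tie; case: ifPn => [_|ij_neq]; first exact: measure0.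
  exact: tie_probability U_indep U_unif _ _ ij_neq.
have P_zero i : P (bad_zero i) = 0%E.
  rewrite -[LHS]/(distribution P (X i) [set y | f y <= 0]) (Xf i) //.
  apply: integral0_eq => y /= fy; have [_ f0 _] := f_density.
  by congr (_%:E); apply/eqP; rewrite eq_le fy f0.
have [mtie Ptie] := union_bound P (enum {: 'I_n * 'I_n}) mbad_tie.
have [mzeros Pzero] := union_bound P (enum 'I_n) mbad_zero.
have [mspacing Pspacing] := union_bound P
  [seq (B, k) | B <- index_iota 0 (Bmax R n).+1, k <- index_iota 1 (n_ R n B).+1]
  mbad.
set tie := [set w | _] in mtie Ptie; set zero := [set w | _] in mzeros Pzero.
set bad := [set w | _] in mspacing Pspacing.
exists (~` (tie `|` (zero `|` bad))); split.
- by apply: measurableC; do ! apply: measurableU.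
- move=> w /not_orP[no_tie /not_orP[no_zero no_bad]].
  have inj_u : injective (fun i => U i w).
    move=> i j uij; apply/eqP/negPn/negP => ij; apply: no_tie.
    by exists (i, j); rewrite ?mem_enum //= /bad_tie (negbTE ij).
  apply: band_covers => //; first exact: m_ge8.
    by move=> i; rewrite ltNge; apply/negP => fy; apply: no_zero; exists i;
      rewrite ?mem_enum.
  move=> B k BB kB; rewrite -[_ \o _]/(fun i => U i w).
  apply: good_spacing => // hbad; apply: no_bad.
  by exists (B, k) => //; apply/allpairsPdep; exists B, k;
    rewrite !mem_index_iota /= !ltnS.
- rewrite probability_setC; last by do ! apply: measurableU.
  rewrite EFinB leeB //.
  apply: le_trans (measureU2 P mtie (measurableU _ _ mzeros mspacing)) _.
  rewrite -[leRHS]add0e leeD //.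
    by apply: le_trans Ptie _; rewrite big1.
  apply: le_trans (measureU2 P mzeros mspacing) _.
  rewrite -[leRHS]add0e leeD //.
    by apply: le_trans Pzero _; rewrite big1.
  apply: le_trans Pspacing _; rewrite big_allpairs_dep.
  apply: le_trans (_ : (\sum_(0 <= B < (Bmax R n).+1) \sum_(1 <= k < (n_ R n B).+1)
     (level n alpha B + level n alpha B)%:E <= _)%E); last first.
    under eq_bigr do rewrite sumEFin.
    by rewrite sumEFin lee_fin level_sum_le.
  apply: lee_sum => B _; rewrite big_nat [leRHS]big_nat.
  by apply: lee_sum => k kB; apply: bad_spacing_probability => //; lia.
Qed.
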